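(* Let $d\ge2$ and let $Y_1,\ldots,Y_n$ be (possibly dependent) random vectors in $\mathbb{R}^d$ that are almost surely in type $A$ general position. Then, for $k=1,\ldots,d$, the expected number of $k$-faces of the Weyl random cone $\mathcal{D}_n^A$ of type $A_{n-1}$ is $$\mathbb{E} f_k(\mathcal{D}_n^A)=\frac{\binom{n-1}{d-k}D^A(n-d+k,k)}{D^A(n,d)}\cdot\frac{n!}{(n-d+k)!}.$$
   Context: Type $A$ general position: vectors $y_1,\ldots,y_n\in\mathbb{R}^d$ are said to be in type $A$ general position if $n\ge d+1$ and, for every permutation $\sigma$ of $\{1,\ldots,n\}$, any $d$ of the vectors $y_{\sigma(1)}-y_{\sigma(2)},\ldots,y_{\sigma(n-1)}-y_{\sigma(n)}$ are linearly independent. For $x\in\mathbb{R}^d\setminus\{0\}$ let $x^\perp=\{v\in\mathbb{R}^d:\langle v,x\rangle=0\}$. The Weyl tessellation $\mathcal{W}^A(y_1,\ldots,y_n)$ of type $A_{n-1}$ is the set of cones obtained as closures of the connected components of $\mathbb{R}^d\setminus\bigcup_{1\le i<j\le n}(y_i-y_j)^\perp$. The Weyl random cone $\mathcal{D}_n^A$ is obtained by choosing uniformly at random one of the cones of the random tessellation $\mathcal{W}^A(Y_1,\ldots,Y_n)$; that is, for a functional $\varphi$ of cones, $\mathbb{E}\varphi(\mathcal{D}_n^A)=\mathbb{E}\big[\frac{1}{\#\mathcal{W}^A(Y_1,\ldots,Y_n)}\sum_{C\in\mathcal{W}^A(Y_1,\ldots,Y_n)}\varphi(C)\big]$. For a polyhedral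 cone $C$, $f_k(C)$ is the number of its $k$-dimensional faces, where faces are obtained by replacing some (possibly none) of the half-spaces defining $C$ by their boundaries. The Stirling numbers of the first kind are defined by $t(t+1)\cdots(t+n-1)=\sum_{k=1}^n\genfrac{[}{]}{0pt}{}{n}{k}t^k$, with $\genfrac{[}{]}{0pt}{}{n}{k}=0$ for $k\notin\{1,\ldots,n\}$, and $D^A(m,k):=2\sum_{i\ge 0}\genfrac{[}{]}{0pt}{}{m}{m-k+1+2i}$. *)

(* Defs.v *)
From HB Require Import structures.
From mathcomp Require Import all_boot all_order all_fingroup all_algebra finmap.
From mathcomp Require Import all_classical all_reals all_analysis.
Import numFieldNormedType.Exports.

Set Implicit Arguments.
Unset Strict Implicit.
Unset Printing Implicit Defensive.

Import Order.TTheory GRing.Theory Num.Theory.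

Local Open Scope classical_set_scope.
Local Open Scope ring_scope.

(* [n; k]. The polynomial alone would give [0; 0] = 1; the guard enforces the
   convention that [n; k] = 0 for k outside {1, ..., n}. *)
Definition stirling1 (n k : nat) : nat :=
  if (0 < k <= n)%N then (\prod_(i < n) ('X + (i : nat)%:P) : {poly nat})`_k else 0%N.

(* D^A(m, k) = 2 * \sum_(i >= 0) [m; m - k + 1 + 2 i]. The terms with i >= k
   vanish, their lower index being larger than m. A negative lower index is
   truncated to 0, where stirling1 vanishes too. *)
Definition DA (m k : nat) : nat :=
  (2 * \sum_(i < k) stirling1 m (m.+1 + 2 * i - k))%N.

Section Cones.
Variables (R : realType) (d : nat).
Implicit Types (C F : set 'rV[R]_d) (s t : seq 'rV[R]_d).

Definition dotv (u v : 'rV[R]_d) : R := \sum_(j < d) u ord0 j * v ord0 j.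

Definition orthv (x : 'rV[R]_d) : set 'rV[R]_d := [set v | dotv v x = 0].

Definition polycone s : set 'rV[R]_d :=
  [set v | forall a, a \in s -> 0 <= dotv v a].

(* The half-spaces with normal vector in t are replaced by their boundaries.
   The set of faces of C does not depend on the representation s of C. *)
Definition is_face C F : Prop :=
  exists s t : seq 'rV[R]_d,
    [/\ 0 \notin s, {subset t <= s}, C = polycone s &
        F = polycone [seq a <- s | a \notin t]
            `&` \bigcap_(a in [set` t]) orthv a].

(* k is the dimension of the linear hull of F. *)
Definition has_dim F (k : nat) : Prop :=
  exists2 U : {vspace 'rV[R]_d}, \dim U = k &
    F `<=` [set` U] /\
    forall V : {vspace 'rV[R]_d}, F `<=` [set` V] -> (U <= V)%VS.

Definition num_faces (k : nat) C : nat :=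
  #|` fset_set [set F | is_face C F /\ has_dim F k]|%fset.

End Cones.

Section Weyl.
Variables (R : realType) (d n : nat).
Implicit Types y : 'I_n -> 'rV[R]_d.

(* ordS i is i + 1 for every i in J. *)
Definition type_A_general_position y : Prop :=
  (d.+1 <= n)%N /\
  forall (s : 'S_n) (J : {set 'I_n}),
    (forall i, i \in J -> (i.+1 < n)%N) -> #|J| = d ->
    free [seq y (s i) - y (s (ordS i)) | i <- enum J].

Definition weyl_chambers y : set 'rV[R]_d :=
  ~` \bigcup_(ij in [set ij : 'I_n * 'I_n | (ij.1 < ij.2)%N])
       orthv (y ij.1 - y ij.2).

Definition weyl_tessellation y : set (set 'rV[R]_d) :=
  [set closure (connected_component (weyl_chambers y) x)
     | x in weyl_chambers y].

Definition weyl_average y (phi : set 'rV[R]_d -> R) : R :=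
  (#|` fset_set (weyl_tessellation y)|%fset%:R)^-1
    * \sum_(C \in weyl_tessellation y) phi C.

(* E phi(D_n^A) *)
Definition weyl_cone_expectation (disp : measure_display)
    (T : measurableType disp) (P : probability T R)
    (Y : 'I_n -> T -> 'rV[R]_d) (phi : set 'rV[R]_d -> R) : \bar R :=
  'E_P[fun w => weyl_average (Y ^~ w) phi].

End Weyl.

(* Main.v *)
Require Import Defs.
From HB Require Import structures.
From mathcomp Require Import all_boot all_order all_fingroup all_algebra finmap.
From mathcomp Require Import all_classical all_reals all_analysis.
From mathcomp Require Import measurable_realfun zify ring lra.
Import Order.TTheory GRing.Theory Num.Theory.
Import numFieldNormedType.Exports.
Local Open Scope classical_set_scope.
Local Open Scope ring_scope.

Set Implicit Arguments.
Unset Strict Implicit.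
Unset Printing Implicit Defensive.

(** Let y_1, ..., y_n be in type A general position.  A linear form v orders the
points by the values <v, y_i>.  The chambers of the arrangement correspond to the
strict orders obtained in this way, and a face of the closed chamber of such an
order corresponds to a way of cutting the order into consecutive blocks, for which
some v is constant on every block and strictly decreasing from block to block.
Both counts below depend on the dimension and on the number of points only, so the
average over the chambers is the same number for every y in general position, and
the expectation is that number.

Counting orders ([nrealizable_eq_DA]).  Insert a new point x into a realized order
s of the other points.  The forms that realize s make up an open convex cone K,
and on K the value of x can meet the values of the other points only one at a
time, since these are distinct.  Hence the number of positions at which x can be
inserted exceeds by one the number of points a for which <v, y_x> = <v, y_a> has a
solution in K ([slots]).  Such a solution realizes s within a hyperplane, where
the other points are again in general position.  Summing over s shows that the
number of orders satisfies the recursion N(m + 1, e) = N(m, e) + m N(m, e - 1),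
which DA satisfies because of the recursion of the Stirling numbers ([DA_rec]).
To run this induction, general position is phrased for a subspace of forms and by
colourings ([generic]).

Counting faces ([face_realizable_count]).  Cut the points into m = n - d + k
ordered blocks.  On the space of forms that are constant on the blocks, which has
dimension k, the blocks are themselves m points in general position, so exactly
DA m k of the m! arrangements of the same blocks are realized.  There are
n! 'C(n - 1, d - k) lists of m blocks in all, and double counting over the
rearrangements of the blocks gives n! / m! 'C(n - 1, d - k) DA m k realized lists.
If a form realizes a list of blocks, a small perturbation breaks the ties inside
the blocks as prescribed ([realizable_of_weakly_sorted]); so the realized lists
correspond to the pairs of a chamber, given by the concatenation of the list, and
a k-face of it.

Geometry.  A face, defined through an arbitrary system of half-spaces that cuts out
the cone, contains a form v with as few ties as possible; a form that shares
these ties can be added to or subtracted from v in small multiples without leaving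
the cone, which determines the face by the ties of v ([face_is_face_of]). *)

(** * The recursion for DA *)

Lemma stirling1_0 n : stirling1 n 0 = 0%N.
Proof. by []. Qed.

Lemma stirling1_gt n k : (n < k)%N -> stirling1 n k = 0%N.
Proof. by rewrite /stirling1 => nk; case: ifP => //; lia. Qed.

Lemma rising_coef0 n : (\prod_(i < n.+1) ('X + (i : nat)%:P) : {poly nat})`_0 = 0%N.
Proof. by rewrite big_ord_recl addr0 coefXM. Qed.

Lemma rising_coef_gt n k : (n < k)%N ->
  (\prod_(i < n) ('X + (i : nat)%:P) : {poly nat})`_k = 0%N.
Proof.
elim: n k => [|n IH] [|k] // nk; first by rewrite big_ord0 coef1.
by rewrite big_ord_recr /= mulrDr coefD coefMX coefMC /= !IH ?mul0r //; lia.
Qed.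

Lemma stirling1E n k :
  stirling1 n.+1 k = (\prod_(i < n.+1) ('X + (i : nat)%:P) : {poly nat})`_k.
Proof.
rewrite /stirling1; case: k => [|k]; first by rewrite rising_coef0.
by case: ifP => // /negbT; rewrite -ltnNge => ?; rewrite rising_coef_gt.
Qed.

Lemma stirling1_rec n k :
  stirling1 n.+2 k.+1 = (stirling1 n.+1 k + n.+1 * stirling1 n.+1 k.+1)%N.
Proof.
rewrite !stirling1E big_ord_recr /= mulrDr coefD coefMX coefMC /=.
by rewrite [in RHS]mulnC.
Qed.

Lemma DA_0 m : DA m 0 = 0%N.
Proof. by rewrite /DA big_ord0. Qed.

(** The recursion is term by term that of the Stirling numbers.  The truncated
lower indices are harmless because every term with lower index zero vanishes. *)
Lemma DA_rec m k : DA m.+2 k.+1 = (DA m.+1 k.+1 + m.+1 * DA m.+1 k)%N.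
Proof.
rewrite /DA mulnCA -mulnDr; congr muln.
have -> : (\sum_(i < k) stirling1 m.+1 (m.+2 + 2 * i - k) =
           \sum_(i < k.+1) stirling1 m.+1 (m.+2 + 2 * i - k))%N.
  by rewrite big_ord_recr /= [X in (_ + X)%N]stirling1_gt ?addn0 //; lia.
rewrite big_distrr -big_split /=; apply: eq_bigr => i _.
have [h|h] := leqP k (m.+1 + 2 * i).
  have -> : (m.+3 + 2 * i - k.+1 = (m.+1 + 2 * i - k).+1)%N by lia.
  have -> : (m.+2 + 2 * i - k.+1 = m.+1 + 2 * i - k)%N by lia.
  have -> : (m.+2 + 2 * i - k = (m.+1 + 2 * i - k).+1)%N by lia.
  exact: stirling1_rec.
have -> : (m.+3 + 2 * i - k.+1 = 0)%N by lia.
have -> : (m.+2 + 2 * i - k.+1 = 0)%N by lia.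
have -> : (m.+2 + 2 * i - k = 0)%N by lia.
by rewrite !stirling1_0 muln0.
Qed.

Lemma stirling1_1 k : stirling1 1 k = (k == 1)%N.
Proof.
case: k => [|[|k]] //.
by rewrite stirling1E big_ord1 coefD coefX coefC.
Qed.

(** By parity, exactly one of the lower indices is 1 or 2, and both numbers are 1. *)
Lemma DA_2 k : DA 2 k.+1 = 2.
Proof.
rewrite DA_rec mul1n /DA -mulnDr (eq_bigr (fun i : 'I_k.+1 => (2 * i == k)%N : nat)); last first.
  by move=> i _; rewrite stirling1_1; congr nat_of_bool; lia.
rewrite [X in (_ + X)%N](eq_bigr (fun i : 'I_k => ((2 * i).+1 == k)%N : nat)); last first.
  by move=> i _; rewrite stirling1_1; congr nat_of_bool; lia.
suff -> : (\sum_(i < k.+1) (2 * i == k)%N + \sum_(i < k) ((2 * i).+1 == k)%N = 1)%N by [].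
pose h := k./2; have := odd_double_half k; rewrite -mul2n -/h.
case: (odd k) => /= hk.
  rewrite big1 ?add0n; last by move=> i _; apply/eqP; lia.
  have hl : (h < k)%N by lia.
  rewrite (bigD1 (Ordinal hl)) //= big1; last first.
    move=> i /eqP ih; apply/eqP; rewrite eqb0; apply/eqP => e; apply: ih; apply: val_inj => /=; lia.
  have -> : ((2 * h).+1 == k)%N by lia.
  by [].
rewrite [X in (_ + X)%N]big1 ?addn0; last by move=> i _; apply/eqP; lia.
have hl : (h < k.+1)%N by lia.
rewrite (bigD1 (Ordinal hl)) //= big1; last first.
  move=> i /eqP ih; apply/eqP; rewrite eqb0; apply/eqP => e; apply: ih; apply: val_inj => /=; lia.
have -> : (2 * h == k)%N by lia.
by [].
Qed.

(** * Linear forms and perturbation *)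

Section Dotv.
Context {R : realType} {d : nat}.
Implicit Types u v w : 'rV[R]_d.

Lemma dotvDl u v w : dotv (u + v) w = dotv u w + dotv v w.
Proof. by rewrite -big_split; apply: eq_bigr => j _; rewrite mxE mulrDl. Qed.

Lemma dotvZl a v w : dotv (a *: v) w = a * dotv v w.
Proof. by rewrite /dotv mulr_sumr; apply: eq_bigr => j _; rewrite mxE mulrA. Qed.

Lemma dotvC v w : dotv v w = dotv w v.
Proof. by apply: eq_bigr => j _; rewrite mulrC. Qed.

Lemma dotvDr u v w : dotv w (u + v) = dotv w u + dotv w v.
Proof. by rewrite dotvC dotvDl !(dotvC w). Qed.

Lemma dotvNr v w : dotv w (- v) = - dotv w v.
Proof. by rewrite dotvC -scaleN1r dotvZl mulN1r dotvC. Qed.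

Lemma dotvBr u v w : dotv w (u - v) = dotv w u - dotv w v.
Proof. by rewrite dotvDr dotvNr. Qed.

Lemma dotvNl v w : dotv (- v) w = - dotv v w.
Proof. by rewrite dotvC dotvNr dotvC. Qed.

Lemma dotv0l w : dotv 0 w = 0.
Proof. by rewrite -(scale0r 0) dotvZl mul0r. Qed.

End Dotv.

Lemma perturb_pos (R : realType) (l : seq (R * R)) :
  (forall x, x \in l -> 0 < x.1) ->
  exists2 e : R, 0 < e & forall x, x \in l -> 0 < x.1 + e * x.2.
Proof.
move=> h.
suff [e e0 he] : exists2 e : R, 0 < e &
    forall e', 0 < e' <= e -> forall x, x \in l -> 0 < x.1 + e' * x.2.
  by exists e => // x xl; apply: he; rewrite ?e0 /=.
elim: l h => [|[p q] l IH] h; first by exists 1.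
have [|e e0 he] := IH; first by move=> x xl; apply: h; rewrite inE xl orbT.
have p0 : 0 < p by apply: (h (p, q)); rewrite inE eqxx.
have q0 : 0 < `|q| + 1 by have := normr_ge0 q; lra.
exists (Num.min e (p / (`|q| + 1))).
  by rewrite lt_min e0 divr_gt0.
move=> e' /andP[e'0]; rewrite le_min => /andP[e'e].
rewrite ler_pdivlMr // => e'p x; rewrite inE => /predU1P[->|xl] /=; last first.
  by apply: he; rewrite ?e'0.
have : - `|q| <= q by rewrite lerNl -normrN ler_norm.
move=> qq; have : e' * - `|q| <= e' * q by rewrite ler_pM2l.
by rewrite mulrDr mulr1 in e'p => e'q; nra.
Qed.

Section Perturb.
Context {R : realType} {d : nat} {I : eqType} (y : I -> 'rV[R]_d).

Lemma perturb_gt (s : seq I) (v u : 'rV[R]_d) :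
  exists2 e : R, 0 < e & forall a b, a \in s -> b \in s ->
    dotv v (y b) < dotv v (y a) -> dotv (v + e *: u) (y b) < dotv (v + e *: u) (y a).
Proof.
pose l := [seq (dotv v (y a.1) - dotv v (y a.2), dotv u (y a.1) - dotv u (y a.2))
  | a <- allpairs pair s s & dotv v (y a.2) < dotv v (y a.1)].
have [|e e0 he] := @perturb_pos R l.
  by move=> ? /mapP[[a b]]; rewrite mem_filter => /andP[/= ab _] -> /=; rewrite subr_gt0.
exists e => // a b aS bS ab.
have := he (dotv v (y a) - dotv v (y b), dotv u (y a) - dotv u (y b)).
rewrite !dotvDl !dotvZl /= => h; rewrite -subr_gt0.
suff /h : (dotv v (y a) - dotv v (y b), dotv u (y a) - dotv u (y b)) \in l by lra.
apply/mapP; exists (a, b) => //; rewrite mem_filter ab /=.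
by apply/allpairsP; exists (a, b).
Qed.

End Perturb.

Section SolDim.
Context {R : realType} {d : nat}.
Implicit Types (A : 'rV[R]_d -> Prop) (v w : 'rV[R]_d).

(** Subspaces of forms are handled as predicates, so that cutting one by further
equations is a conjunction; the underlying vector space only serves to measure
dimension. *)
Definition sol_dim A (e : nat) : Prop :=
  exists2 U : {vspace 'rV[R]_d}, \dim U = e & forall v, v \in U <-> A v.

Lemma sol_dim_ext A B e : (forall v, A v <-> B v) -> sol_dim A e -> sol_dim B e.
Proof. by move=> AB [U dU hU]; exists U => // v; rewrite hU. Qed.

Lemma sol_dim_uniq A e f : sol_dim A e -> sol_dim A f -> e = f.
Proof.
move=> [U <- hU] [V <- hV]; congr (\dim _).
by apply/vspaceP => v; apply/idP/idP => [/hU/hV|/hV/hU].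
Qed.

Lemma sol_dim_lin A e a b v w : sol_dim A e -> A v -> A w -> A (a *: v + b *: w).
Proof. by move=> [U _ hU] /hU Uv /hU Uw; apply/hU; rewrite rpredD // rpredZ. Qed.

Lemma sol_dim0 A : sol_dim A 0 -> forall v, A v -> v = 0.
Proof.
move=> [U dU hU] v /hU; have /eqP := dU; rewrite dimv_eq0 => /eqP ->.
by rewrite memv0 => /eqP.
Qed.

End SolDim.

(** * General position in a subspace of forms *)

Section Generic.
Context {R : realType} {d : nat} {I : eqType} (y : I -> 'rV[R]_d).
Implicit Types (A : 'rV[R]_d -> Prop) (v w : 'rV[R]_d) (S s : seq I)
  (c : I -> nat).

Definition colour_constant c S v : Prop :=
  forall a b, a \in S -> b \in S -> c a = c b -> dotv v (y a) = dotv v (y b).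

(** For the equivalence relation on S given by the colours, size S minus the number
of colours is the number of independent equations that identify equivalent points;
general position says that they cut the dimension e of A by as much as possible.
Colourings make this notion stable under removing a point ([generic_cons]), under
passing to a hyperplane of ties ([generic_tie]) and under merging points into
blocks ([generic_blocks]): in each case a colouring of the new points induces one of
the old points. *)
Definition generic A (e : nat) S : Prop := forall c : I -> nat,
  sol_dim (fun v => A v /\ colour_constant c S v)
          (e - (size S - size (undup (map c S)))).

Lemma generic_dim A e S : uniq S -> generic A e S -> sol_dim A e.
Proof.
move=> uS /(_ (index^~ S)).
have ui : uniq (map (index^~ S) S).
  rewrite map_inj_in_uniq // => a b aS bS /(congr1 (nth a S)).
  by rewrite !nth_index.
rewrite undup_id // size_map subnn subn0.
apply: sol_dim_ext => v; split=> [[]|Av] //; split=> // a b aS bS.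
by move/(congr1 (nth a S)); rewrite !nth_index // => ->.
Qed.

(** A fresh colour for x adds no equation. *)
Lemma generic_cons A e x S : x \notin S -> generic A e (x :: S) -> generic A e S.
Proof.
move=> xS gA c; pose c' i := if i == x then 0%N else (c i).+1.
have c'S i : i \in S -> c' i = (c i).+1.
  by move=> iS; rewrite /c'; case: eqP => // ix; rewrite ix (negPf xS) in iS.
have c'x : c' x = 0%N by rewrite /c' eqxx.
have := gA c'; rewrite /= c'x.
have -> : map c' S = map succn (map c S) by rewrite -map_comp; apply/eq_in_map.
rewrite ifN; last by apply/negP => /mapP[].
rewrite undup_map_inj; last exact: succn_inj.
rewrite /= size_map subSS; apply: sol_dim_ext => v; split=> -[Av hv]; split=> //.
  by move=> a b aS bS ab; apply: hv; rewrite ?inE ?aS ?bS ?orbT // !c'S ?ab.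
move=> a b; rewrite !inE /c'.
have [->|_] /= := eqVneq a x; have [->|_] //= := eqVneq b x.
by move=> aS bS [] /hv; apply.
Qed.

(** Giving x the colour of a adds one point and no colour, hence one equation. *)
Lemma generic_tie A e x a S : x \notin S -> a \in S -> generic A e (x :: S) ->
  generic (fun v => A v /\ dotv v (y x) = dotv v (y a)) e.-1 S.
Proof.
move=> xS aS gA c; pose c' i := if i == x then c a else c i.
have c'S i : i \in S -> c' i = c i.
  by move=> iS; rewrite /c'; case: eqP => // ix; rewrite ix (negPf xS) in iS.
have c'x : c' x = c a by rewrite /c' eqxx.
have := gA c'; rewrite /= c'x.
have -> : map c' S = map c S by apply/eq_in_map.
rewrite map_f //.
have : (size (undup (map c S)) <= size S)%N by rewrite (leq_trans (size_undup _)) ?size_map.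
move: (size (undup _)) => u uS.
have -> : (e - ((size S).+1 - u) = e.-1 - (size S - u))%N by lia.
apply: sol_dim_ext => v; split=> [[Av hv]|[[Av hxa] hv]].
  split; first split => //.
    by apply: hv; rewrite ?inE ?eqxx ?aS ?orbT // c'x c'S.
  by move=> i j iS jS ij; apply: hv; rewrite ?inE ?iS ?jS ?orbT // !c'S.
split=> // i j; rewrite !inE /c'.
have [->|_] /= := eqVneq i x; have [->|_] //= := eqVneq j x.
- by move=> _ jS e1; rewrite hxa; apply: hv.
- by move=> iS _ e1; rewrite hxa; apply: hv.
- by move=> iS jS e1; apply: hv.
Qed.

Lemma generic_separates A e x a S : uniq (x :: S) -> a \in S ->
  generic A e.+1 (x :: S) -> exists2 w, A w & dotv w (y x) <> dotv w (y a).
Proof.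
move=> /[dup] uxS /= /andP[xS uS] aS gA; apply: contrapT => h.
have d1 := generic_dim uxS gA.
have d2 := generic_dim uS (generic_tie xS aS gA).
suff : e.+1 = e by lia.
apply: (sol_dim_uniq d1); apply: sol_dim_ext d2 => v; split=> [[]|Av] //.
by split=> //; apply: contrapT => ne; apply: h; exists v.
Qed.

(** * Counting the realized orders *)

Definition realizes v s : bool :=
  sorted (fun a b => dotv v (y b) < dotv v (y a)) s.

Definition realizable A s : Prop := exists2 v, A v & realizes v s.

Lemma gt_dotv_trans v : transitive (fun a b => dotv v (y b) < dotv v (y a)).
Proof. by move=> b a c ab bc; apply: lt_trans bc ab. Qed.

Lemma realizes_lin v w a b s : 0 < a -> 0 <= b -> realizes v s -> realizes w s ->
  realizes (a *: v + b *: w) s.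
Proof.
move=> a0 b0; rewrite /realizes; case: s => //= i s.
elim: s i => //= j s IH i /andP[vij vs] /andP[wij ws]; rewrite IH // andbT.
rewrite !dotvDl !dotvZl ltr_leD ?ltr_pM2l //.
by rewrite ler_wpM2l // ltW.
Qed.

Lemma realizes_perturb v w s : realizes v s ->
  exists2 e : R, 0 < e & realizes (v + e *: w) s.
Proof.
move=> vs.
have [e e0 he] := perturb_gt y s v w; exists e => //.
by apply: (@sub_in_sorted _ (mem s)) vs; [move=> a b; apply: he|apply/allP].
Qed.

Lemma realizes_insert v x s1 s2 : realizes v (s1 ++ x :: s2) =
  [&& realizes v (s1 ++ s2), all (fun a => dotv v (y x) < dotv v (y a)) s1
    & all (fun b => dotv v (y b) < dotv v (y x)) s2].
Proof.
rewrite /realizes !(sorted_pairwise (@gt_dotv_trans v)) !pairwise_cat /=.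
rewrite allrel_consr.
by do ![case: (pairwise _ _)|case: (all _ _)|case: (allrel _ _ _)].
Qed.

Lemma realizes_slot v x s1 s2 : realizes v (s1 ++ s2) ->
  (s1 != [::] -> dotv v (y x) < dotv v (y (last x s1))) ->
  (s2 != [::] -> dotv v (y (head x s2)) < dotv v (y x)) ->
  realizes v (s1 ++ x :: s2).
Proof.
rewrite /realizes; case: s1 => [|c s1]; case: s2 => [|b s2] //=.
- by move=> -> _ ->.
- by rewrite !cats0 cats1 rcons_path => -> /= h _; apply: h.
- by rewrite !cat_path /= => /and3P[-> _ ->] -> // ->.
Qed.

(** Since up holds on an initial part of s and dn on a final part, and the two parts
cover s, the cuts p with up before and dn after are the ones inside the overlap,
one more than its number of elements. *)
Lemma count_slots (up dn : pred I) s :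
  pairwise (fun a b => up b ==> up a) s ->
  pairwise (fun a b => dn a ==> dn b) s ->
  all (predU up dn) s ->
  (\sum_(p <- iota 0 (size s).+1) (all up (take p s) && all dn (drop p s))
   = (count (predI up dn) s).+1)%N.
Proof.
elim: s => [|a s IH]; first by rewrite /= big_seq1.
have -> : iota 0 (size (a :: s)).+1 = 0%N :: map (addn 1) (iota 0 (size s).+1).
  by rewrite -iotaDl.
rewrite big_cons big_map => /= /andP[upa ups] /andP[dna dns] /andP[ud uds].
rewrite (eq_bigr (fun p => (up a && (all up (take p s) && all dn (drop p s))) : nat));
  last by move=> p _; rewrite andbA.
case ua: (up a) ud => /=.
  move=> _; rewrite IH //; case da: (dn a) => //=.
    suff -> : all dn s by rewrite add1n.
    by apply: sub_all dna => b; rewrite da.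
move=> da; rewrite da big1_eq addn0 /=.
have -> : all dn s by apply: sub_all dna => b; rewrite da.
rewrite (@eq_in_count _ _ pred0) ?count_pred0 // => b bs /=.
by move/allP: upa => /(_ b bs); rewrite ua implybF => /negPf ->.
Qed.

Section Slots.
Variables (A : 'rV[R]_d -> Prop) (e : nat) (x : I) (S : seq I).
Hypotheses (uxS : uniq (x :: S)) (gA : generic A e.+1 (x :: S)).

Let A_lin a b v w : A v -> A w -> A (a *: v + b *: w).
Proof. by apply: sol_dim_lin; apply: generic_dim gA. Qed.

Let A_sub a v w : A v -> A w -> A (v + a *: w).
Proof. by rewrite -[X in X + _]scale1r; apply: A_lin. Qed.

Let above s a := exists2 v, A v /\ realizes v s & dotv v (y x) < dotv v (y a).
Let below s a := exists2 v, A v /\ realizes v s & dotv v (y a) < dotv v (y x).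

(** It is enough to be above the last element of s1 and below the first element of
s2.  If two forms v and w that achieve one of these each both fail the other, the
combination of v and w for which the value of x is the midpoint between those of
its neighbours achieves both. *)
Lemma slot_realizable s1 s2 : realizable A (s1 ++ s2) ->
  {in s1, forall a, above (s1 ++ s2) a} -> {in s2, forall b, below (s1 ++ s2) b} ->
  realizable A (s1 ++ x :: s2).
Proof.
move=> [v0 Av0 v0s].
case: (lastP s1) v0s => [|s1' a] v0s ab be.
  case: s2 v0s be {ab} => [|b s2] v0s be; first by exists v0.
  by have [|v [Av vs] vb] := be b; rewrite ?mem_head //; exists v => //; apply: realizes_slot.
case: s2 v0s ab be => [|b s2] v0s ab be.
  have [|v [Av vs] vb] := ab a; first by rewrite mem_rcons mem_head.
  by exists v => //; apply: realizes_slot => //; rewrite last_rcons.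
have [|v [Av vs] va] := ab a; first by rewrite mem_rcons mem_head.
have [|w [Aw ws] wb] := be b; first by rewrite mem_head.
have ba u : realizes u (rcons s1' a ++ b :: s2) -> dotv u (y b) < dotv u (y a).
  by rewrite realizes_insert all_rcons => /and3P[_ /andP[]].
have [u [Au us] [ua ub]] : exists2 u, A u /\ realizes u (rcons s1' a ++ b :: s2)
    & dotv u (y x) < dotv u (y a) /\ dotv u (y b) < dotv u (y x).
  have [vb|vb] := ltP (dotv v (y b)) (dotv v (y x)); first by exists v.
  have [wa|wa] := ltP (dotv w (y x)) (dotv w (y a)); first by exists w.
  have vba := ba v vs; have wba := ba w ws.
  (* The coefficients solve the midpoint equation, which is linear in v and w. *)
  exists ((2 * dotv w (y x) - dotv w (y b) - dotv w (y a)) *: v +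
          (dotv v (y a) + dotv v (y b) - 2 * dotv v (y x)) *: w).
    by split; [exact: A_lin|apply: realizes_lin => //; lra].
  by rewrite !dotvDl !dotvZl; split; nra.
by exists u => //; apply: realizes_slot => //; rewrite last_rcons.
Qed.

(** A tie is broken in both directions by a form that separates x from a. *)
Lemma tie_perturb s a v : a \in S -> A v -> realizes v s ->
  dotv v (y x) = dotv v (y a) -> above s a /\ below s a.
Proof.
move=> aS Av vs vxa; have [w Aw /eqP wxa] := generic_separates uxS aS gA.
wlog wlt : w Aw wxa / dotv w (y x) < dotv w (y a).
  move=> H; move: wxa; rewrite neq_lt => /orP[h|h]; first by apply: (H w) => //; lra.
  have Aw' : A (- w) by rewrite -scaleN1r -[X in A X]add0r -(scale0r v); apply: A_lin.
  by apply: (H (- w)); rewrite ?dotvNl //; [apply/eqP|]; lra.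
have [g g0 gs] := realizes_perturb w vs.
have [f f0 fs] := realizes_perturb (- w) vs.
rewrite scalerN -scaleNr in fs.
split.
  exists (v + g *: w); first by split; first exact: A_sub.
  by rewrite !dotvDl !dotvZl; nra.
exists (v + (- f) *: w); first by split; first exact: A_sub.
by rewrite !dotvDl !dotvZl; nra.
Qed.

(** Among the positive combinations of a form above and a form below, one is a tie. *)
Lemma tie_realizable s a : a \in S ->
  realizable (fun v => A v /\ dotv v (y x) = dotv v (y a)) s <->
  above s a /\ below s a.
Proof.
move=> aS; split=> [[v [Av vxa] vs]|[[v [Av vs] va] [w [Aw ws] wa]]].
  exact: tie_perturb vxa.
exists ((dotv w (y x) - dotv w (y a)) *: v + (dotv v (y a) - dotv v (y x)) *: w).
  split; first exact: A_lin.
  by rewrite !dotvDl !dotvZl; ring.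
by apply: realizes_lin => //; lra.
Qed.

Lemma above_or_below s a : a \in S -> realizable A s -> above s a \/ below s a.
Proof.
move=> aS [v Av vs]; have [va|va|va] := ltgtP (dotv v (y x)) (dotv v (y a)).
- by left; exists v.
- by right; exists v.
- by left; have [] := tie_perturb aS Av vs va.
Qed.

(** The cone of forms that realize s is crossed by the hyperplanes of ties between x
and the points of s, and these do not meet inside the cone; they cut it into one
more piece than their number. *)
Lemma slots s : perm_eq s S -> realizable A s ->
  (\sum_(p <- iota 0 (size s).+1) `[<realizable A (take p s ++ x :: drop p s)>]
   = (\sum_(a <- s)
        `[<realizable (fun v => A v /\ dotv v (y x) = dotv v (y a)) s>]).+1)%N.
Proof.
move=> sS rs; have [v0 Av0 v0s] := rs.
pose up a := `[<above s a>]; pose dn a := `[<below s a>].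
rewrite (eq_bigr (fun p => all up (take p s) && all dn (drop p s) : nat)); last first.
  move=> p _; congr nat_of_bool; apply/asboolP/andP; rewrite /up /dn.
    move=> [v Av]; rewrite realizes_insert cat_take_drop => /and3P[vs va vb]; split.
      by apply: sub_all va => a va; apply/asboolP; exists v.
    by apply: sub_all vb => b vb; apply/asboolP; exists v.
  move=> [/allP ab /allP be]; apply: slot_realizable; rewrite cat_take_drop //.
    by move=> a /ab /asboolP.
  by move=> b /be /asboolP.
rewrite count_slots.
- congr _.+1; rewrite -sum1_count [LHS]big_mkcond /=; apply: eq_big_seq => a.
  rewrite (perm_mem sS) => aS; rewrite (_ : `[<_>] = up a && dn a); first by case: (_ && _).
  by apply/asboolP/andP => [/(tie_realizable _ aS)[]|[/asboolP ? /asboolP ?]];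
    [split; apply/asboolP|apply/tie_realizable].
- apply/(pairwiseP x) => i j si sj ij; apply/implyP => /asboolP[v [Av vs] vj].
  apply/asboolP; exists v => //; apply: lt_trans vj _.
  exact: (sorted_ltn_nth (@gt_dotv_trans v)).
- apply/(pairwiseP x) => i j si sj ij; apply/implyP => /asboolP[v [Av vs] vi].
  apply/asboolP; exists v => //; apply: le_lt_trans vi; apply: ltW.
  exact: (sorted_ltn_nth (@gt_dotv_trans v)).
- apply/allP => a; rewrite (perm_mem sS) => aS.
  by have [h|h] := above_or_below aS rs; apply/orP; [left|right]; apply/asboolP.
Qed.

End Slots.

Definition nrealizable A S := (\sum_(s <- permutations S) `[<realizable A s>])%N.

Lemma perm_insert x S : uniq (x :: S) ->
  perm_eq (permutations (x :: S))
    [seq take p s ++ x :: drop p s | s <- permutations S, p <- iota 0 (size S).+1].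
Proof.
rewrite cons_uniq => /andP[xS uS].
have usx s : perm_eq s S -> x \notin s by move/perm_mem->.
apply: uniq_perm.
- exact: permutations_uniq.
- refine (@allpairs_uniq _ _ _ (fun s p => take p s ++ x :: drop p s) (permutations S) (iota 0 (size S).+1) _ _ _); [exact: permutations_uniq|exact: iota_uniq|].
  move=> [s p] [s' p'] /allpairsP[[? ?] [sS ps [es ep]]].
  move=> /allpairsP[[? ?] [sS' ps' [es' ep']]] E.
  rewrite /= in sS ps es ep sS' ps' es' ep' E.
  rewrite -{}es -{}ep -{}es' -{}ep' in sS ps sS' ps'.
  rewrite mem_permutations in sS; rewrite mem_permutations in sS'.
  have {}ps : (p <= size S)%N by move: ps; rewrite -/(iota 0 (size S).+1) mem_iota.
  have {}ps' : (p' <= size S)%N by move: ps'; rewrite -/(iota 0 (size S).+1) mem_iota.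
  have xt s0 q : perm_eq s0 S -> x \notin take q s0.
    by move=> /usx; apply: contra; apply: mem_take.
  have xi s0 q : perm_eq s0 S -> (q <= size S)%N -> index x (take q s0 ++ x :: drop q s0) = q.
    move=> h hq; rewrite index_cat (negPf (xt _ _ h)) /= eqxx addn0 size_take.
    by rewrite (perm_size h); case: ltngtP hq.
  have epp : p = p' by rewrite -(xi s p) // E xi.
  have rx s0 q : perm_eq s0 S -> rem x (take q s0 ++ x :: drop q s0) = s0.
    by move=> h; rewrite remE index_cat (negPf (xt _ _ h)) /= eqxx addn0 take_size_cat // drop_cat ltnNge leqnSn /= subSnn /= drop0 cat_take_drop.
  by rewrite epp -(rx s p) // E rx.
move=> s; rewrite mem_permutations; apply/idP/allpairsP => [sxS|[[s' p] [+ _ ->]]].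
  have xs : x \in s by rewrite (perm_mem sxS) mem_head.
  case/splitPr: xs sxS => s1 s2 h.
  exists (s1 ++ s2, size s1); split.
  - rewrite [(_, _).1]/= mem_permutations -(perm_cons x); apply: perm_trans h.
    by rewrite -(cat1s x s2) perm_sym perm_catCA.
  - rewrite [(_, _).2]/= mem_iota /=; have := perm_size h; rewrite size_cat /=; lia.
  - by rewrite take_size_cat // drop_size_cat.
rewrite mem_permutations => s'S; rewrite -(cat1s x (drop _ _)) perm_catCA /= perm_cons cat_take_drop.
exact: s'S.
Qed.

Lemma nrealizable_cons A e x S : uniq (x :: S) -> generic A e.+1 (x :: S) ->
  nrealizable A (x :: S) = (nrealizable A S +
    \sum_(a <- S) nrealizable (fun v => A v /\ dotv v (y x) = dotv v (y a)) S)%N.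
Proof.
move=> uxS gA; rewrite /nrealizable (perm_big _ (perm_insert uxS)).
rewrite big_allpairs_dep [X in _ = (_ + X)%N]exchange_big -big_split !big_seq.
apply: eq_bigr => s.
rewrite mem_permutations => sS.
have [rs|nrs] := asboolP (realizable A s).
  by rewrite -(perm_size sS) (slots uxS gA) //= add1n; congr _.+1; apply: perm_big.
rewrite [RHS]/= big1; last first.
  move=> p _; apply/eqP; rewrite eqb0; apply/asboolP.
  move=> [v Av]; rewrite realizes_insert cat_take_drop => /andP[vs _].
  by apply: nrs; exists v.
rewrite big1 // => a _; apply/eqP; rewrite eqb0; apply/asboolP.
by move=> [v [Av _] vs]; apply: nrs; exists v.
Qed.

(** The induction starts from one point, which has one order in every dimension.  In
dimension zero two points always tie. *)
Theorem nrealizable_eq_DA A e S : uniq S -> (1 < size S)%N -> generic A e S ->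
  nrealizable A S = DA (size S) e.
Proof.
elim: S A e => // x S IH A [|e] uxS S1 gA.
  rewrite DA_0 /nrealizable big1_seq //= => s.
  rewrite mem_permutations => /perm_size sS; apply/eqP; rewrite eqb0; apply/asboolP.
  move=> [v Av]; have v0 := sol_dim0 (generic_dim uxS gA) Av.
  case: s sS => [|a [|b s]] /=; [by []|by move: S1 => /= + h; rewrite -h|].
  by move=> _; rewrite v0 /realizes /= !dotv0l ltxx.
have /= /andP[xS uS] := uxS.
rewrite (nrealizable_cons uxS gA).
have {}S1 : (0 < size S)%N by [].
have [S1'|S2] := leqP (size S) 1; last first.
  rewrite (IH _ e.+1 uS) //; last exact: generic_cons gA.
  have -> : (\sum_(a <- S) nrealizable (fun v => A v /\ dotv v (y x) = dotv v (y a)) S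
             = size S * DA (size S) e)%N.
    rewrite (eq_big_seq (fun=> DA (size S) e)) => [|a aS].
      by rewrite big_const_seq count_predT iter_addn_0 mulnC.
    by apply: IH => //; apply: (generic_tie xS aS gA).
  by case: (size S) S2 => [|[|m]] // _; rewrite [RHS]DA_rec.
case: S S1 S1' {IH} uxS gA xS uS => [//|a [|//]] _ _ uxS gA xS _.
rewrite DA_2 big_seq1 /nrealizable.
have -> : permutations [:: a] = [:: [:: a]] by [].
rewrite !big_seq1.
have rl B : B 0 -> `[<realizable B [:: a]>] = true.
  by move=> B0; apply/asboolP; exists 0.
have A0 : A 0.
  have [U _ hU] := generic_dim uxS gA; apply/hU; exact: mem0v.
by rewrite !rl //; split=> //; rewrite !dotv0l.
Qed.

End Generic.

(** * Ordered lists of blocks *)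

Section Blocks.
Context {T : eqType}.
Implicit Types (E s b : seq T) (B : seq (seq T)).

Definition block_list E B : bool := ([::] \notin B) && perm_eq (flatten B) E.

Definition block_of B a : seq T := nth [::] B (find (fun b => a \in b) B).

Lemma block_ofE B b a : uniq (flatten B) -> b \in B -> a \in b -> block_of B a = b.
Proof.
rewrite /block_of; elim: B => //= b' B IH; rewrite cat_uniq inE => /and3P[_ dis uB].
case: ifP => [ab' /predU1P[->//|bB ab]|ab' /predU1P[->|bB ab]] /=.
- by case/hasP: dis; exists a => //; apply/flattenP; exists b.
- by rewrite ab'.
- exact: IH.
Qed.

Lemma uniq_block_list E B : uniq E -> block_list E B -> uniq B.
Proof.
move=> uE /andP[nB /perm_uniq]; rewrite uE.
elim: B nB => //= b B IH; rewrite inE negb_or cat_uniq => /andP[nb nB] /and3P[_ dis uB].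
rewrite IH // andbT; apply: contra dis => bB; case: b nb bB => // a b _ bB.
by apply/hasP; exists a; rewrite ?mem_head //; apply/flattenP; exists (a :: b); rewrite ?mem_head.
Qed.

Lemma perm_block_list E B B' : perm_eq B B' -> block_list E B = block_list E B'.
Proof.
move=> BB'; rewrite /block_list (perm_mem BB').
by have /permPl -> := perm_flatten BB'.
Qed.

Lemma size_flatten_nonempty B : [::] \notin B ->
  size (flatten B) = (\sum_(b <- B) (size b).-1 + size B)%N.
Proof.
elim: B => [|b B IH]; first by rewrite big_nil.
rewrite inE negb_or size_cat big_cons /= => /andP[nb /IH ->].
by case: b nb => //= a b _; lia.
Qed.

Lemma size_block_list E B : block_list E B -> (size B <= size E)%N.
Proof.
by move=> /andP[nB /perm_size <-]; rewrite size_flatten_nonempty //; lia.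
Qed.

(** A list of m + 1 blocks is an order of the points together with a composition of
the number of points into m + 1 positive parts; lowering each part by one gives a
weak composition of j. *)
Lemma block_list_enum E m j : uniq E -> size E = (m.+1 + j)%N ->
  exists L : seq (seq (seq T)),
    [/\ uniq L, size L = ((size E)`! * 'C(m + j, m))%N &
        forall B, (B \in L) = block_list E B && (size B == m.+1)].
Proof.
move=> uE sE.
pose comps := [set t : m.+1.-tuple 'I_j.+1 | (\sum_(i <- t) i)%N == j]%SET.
pose sh (t : m.+1.-tuple 'I_j.+1) : seq nat := [seq (nat_of_ord i).+1 | i : 'I_j.+1 <- val t].
have sh_sum t : t \in comps -> sumn (sh t) = size E.
  rewrite inE => /eqP tj; rewrite sE sumnE big_map -[in RHS]tj.
  under eq_bigr => i _ do rewrite -add1n.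
  by rewrite big_split /= sum1_size size_tuple.
exists [seq reshape (sh t) s | s <- permutations E, t <- enum comps]; split.
- apply: allpairs_uniq; rewrite ?permutations_uniq ?enum_uniq //.
  move=> [s t] [s' t'] /allpairsP[[? ?] /= [hs ht [es et]]].
  move=> /allpairsP[[? ?] /= [hs' ht' [es' et']]] /= eq1.
  move: hs ht hs' ht'; rewrite -{}es -{}et -{}es' -{}et' !mem_permutations !mem_enum.
  move=> hs /sh_sum ht hs' /sh_sum ht'.
  congr (_, _).
    rewrite -(@reshapeKr _ (sh t) s) ?ht ?(perm_size hs) // eq1.
    by rewrite reshapeKr // ht' (perm_size hs').
  apply: val_inj; apply: (inj_map (f := fun i : 'I_j.+1 => (i : nat).+1)).
    by move=> a b [] /val_inj.
  rewrite -/(sh t) -/(sh t') -(@reshapeKl _ (sh t) s) ?ht ?(perm_size hs) // eq1.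
  by rewrite reshapeKl // ht' (perm_size hs').
- by rewrite size_allpairs size_permutations // -cardE card_ord_partitions.
move=> B; apply/allpairsP/andP => [[[s t] /= [+ + ->]]|[bB /eqP sB]].
  rewrite mem_permutations mem_enum => sE' tc.
  have ht := sh_sum t tc.
  have ssh : shape (reshape (sh t) s) = sh t by rewrite reshapeKl // ht (perm_size sE').
  split; last by rewrite -(size_map size) -/(shape _) ssh size_map size_tuple.
  rewrite /block_list reshapeKr ?ht ?(perm_size sE') // sE' andbT.
  apply/negP => /(map_f size); rewrite -/(shape _) ssh => /mapP[i _].
  by [].
have /andP[nB pB] := bB.
have := size_flatten_nonempty nB; rewrite (perm_size pB) sE sB => hj.
have tp : size [seq (inord (size b).-1 : 'I_j.+1) | b <- B] == m.+1 by rewrite size_map sB.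
have hB b : b \in B -> ((inord (size b).-1 : 'I_j.+1) : nat) = (size b).-1.
  move=> bB'; rewrite inordK //; move: hj; rewrite (big_rem b) //=; lia.
have shT : sh (Tuple tp) = shape B.
  rewrite /sh -map_comp; apply/eq_in_map => b bB' /=; rewrite hB //.
  by case: b bB' => // h; rewrite h in nB.
exists (flatten B, Tuple tp) => /=; split.
- by rewrite mem_permutations.
- rewrite mem_enum inE /= big_map; apply/eqP.
  by rewrite (eq_big_seq (fun b => (size b).-1)) => [|b bB' /=]; [apply: (@addnI m.+1); rewrite hj addnC|rewrite hB].
- by rewrite shT flattenK.
Qed.

(** Double counting of the pairs of lists in L that are rearrangements of each other:
each class of rearrangements has m! members, because blocks are distinct. *)
Lemma sum_perm_classes (L : seq (seq (seq T))) E m D (g : seq (seq T) -> nat) :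
  uniq E -> uniq L -> (forall B, (B \in L) = block_list E B && (size B == m)) ->
  (forall B, B \in L -> \sum_(B' <- permutations B) g B' = D)%N ->
  (m`! * \sum_(B <- L) g B = size L * D)%N.
Proof.
move=> uE uL LE gD.
have LB B : B \in L -> perm_eq (permutations B) [seq B' <- L | perm_eq B' B].
  rewrite LE => /andP[bB sB].
  apply: uniq_perm; rewrite ?permutations_uniq ?filter_uniq // => B'.
  rewrite mem_permutations mem_filter LE andb_idr // => BB'.
  by rewrite (perm_block_list _ BB') bB (perm_size BB').
transitivity (\sum_(B <- L) \sum_(B' <- permutations B) g B')%N; last first.
  by rewrite (eq_big_seq (fun=> D)) // big_const_seq count_predT iter_addn_0 mulnC.
rewrite [RHS](eq_big_seq (fun B => \sum_(B' <- L | perm_eq B' B) g B'))%N; last first.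
  by move=> B BL; rewrite /= (perm_big _ (LB B BL)) big_filter.
rewrite [RHS](exchange_big_dep predT) //= big_distrr /=; apply: eq_big_seq => B BL.
rewrite big_const_seq iter_addn_0 mulnC; congr muln.
have := BL; rewrite LE => /andP[/(uniq_block_list uE) uB /eqP <-].
rewrite -size_permutations // (perm_size (LB B BL)) size_filter.
by apply: eq_count => B'; rewrite perm_sym.
Qed.

End Blocks.

Section BlockCount.
Context {R : realType} {d : nat} {T : eqType} (x0 : T) (y : T -> 'rV[R]_d).
Implicit Types (E s b : seq T) (B : seq (seq T)) (v : 'rV[R]_d).

(** A block is represented by its first point.  Where forms are constant on the
blocks, the choice is immaterial, and the default value x0 is never reached since
blocks are nonempty. *)
Definition block_point b : 'rV[R]_d := y (head x0 b).

Definition constant_on B v : Prop :=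
  forall b a, b \in B -> a \in b -> dotv v (y a) = dotv v (block_point b).

Definition face_realizable B : Prop :=
  realizable block_point (constant_on B) B.

Lemma mem_head_block B b : [::] \notin B -> b \in B -> head x0 b \in b.
Proof. by case: b => [/negP//|a b _ _]; rewrite mem_head. Qed.

(** A colouring of the blocks induces one of the points, and the equations that it
imposes include those that make a form constant on the blocks. *)
Lemma generic_blocks E B : uniq E -> generic y (fun=> True) d E ->
  block_list E B ->
  generic block_point (constant_on B) (d - (size E - size B)) B.
Proof.
move=> uE gE bB c; have sBE := size_block_list bB.
have /andP[nB pB] := bB.
have uB : uniq (flatten B) by rewrite (perm_uniq pB).
have := gE (c \o block_of B).
have -> : size (undup (map (c \o block_of B) E)) = size (undup (map c B)).
  apply: perm_size; apply: uniq_perm; rewrite ?undup_uniq // => i.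
  rewrite !mem_undup; apply/mapP/mapP => [[a + ->]|[b bB' ->]] /=.
    rewrite -(perm_mem pB) => /flattenP[b bB' ab].
    by exists b => //; rewrite (block_ofE uB bB' ab).
  have hb := mem_head_block nB bB'; exists (head x0 b).
    by rewrite -(perm_mem pB); apply/flattenP; exists b.
  by rewrite /= (block_ofE uB bB' hb).
have : (size (undup (map c B)) <= size B)%N.
  by rewrite (leq_trans (size_undup _)) ?size_map.
move: (size (undup _)) => u us.
have -> : (d - (size E - u) = d - (size E - size B) - (size B - u))%N by lia.
have EB b a : b \in B -> a \in b -> a \in E.
  by move=> bB' ab; rewrite -(perm_mem pB); apply/flattenP; exists b.
apply: sol_dim_ext => v; split=> [[_ cv]|[kv cv]]; split=> //.
- move=> b a bB' ab; have hb := mem_head_block nB bB'.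
  apply: cv; [exact: EB bB' ab|exact: EB bB' hb|].
  by rewrite /= !(block_ofE uB bB').
- move=> b b' bB' bB'' cbb; have hb := mem_head_block nB bB'.
  have hb' := mem_head_block nB bB''.
  apply: cv; [exact: EB bB' hb|exact: EB bB'' hb'|].
  by rewrite /= (block_ofE uB bB' hb) (block_ofE uB bB'' hb').
move=> a a'; rewrite -!(perm_mem pB) => /flattenP[b bB' ab] /flattenP[b' bB'' ab'] /=.
rewrite (block_ofE uB bB' ab) (block_ofE uB bB'' ab') => cbb.
by rewrite (kv b) // (kv b') //; apply: cv.
Qed.

Lemma eq_constant_on B B' : perm_eq B B' -> forall v, constant_on B v <-> constant_on B' v.
Proof.
by move=> BB' v; split=> h b a bB; apply: h; rewrite ?(perm_mem BB') // -(perm_mem BB').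
Qed.

(** Among the rearrangements of a fixed list of blocks, the realized ones are the
orders of the blocks, seen as points of the space of forms constant on them. *)
Lemma face_realizable_count E m j :
  uniq E -> size E = (m.+2 + j)%N -> generic y (fun=> True) d E ->
  exists L : seq (seq (seq T)),
    [/\ uniq L, forall B, (B \in L) = block_list E B && (size B == m.+2) &
      (m.+2`! * \sum_(B <- L) `[<face_realizable B>] =
         (size E)`! * 'C(m.+1 + j, m.+1) * DA m.+2 (d - j))%N].
Proof.
move=> uE sE gE; have [L [uL sL LE]] := block_list_enum uE sE.
exists L; split=> //; rewrite -sL; apply: (sum_perm_classes uE uL LE) => B.
rewrite LE => /andP[bB /eqP sB].
have uB := uniq_block_list uE bB.
have := nrealizable_eq_DA uB _ (generic_blocks uE gE bB).
rewrite sB sE addKn => <- //; rewrite /nrealizable.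
apply: eq_big_seq => B'; rewrite mem_permutations => BB'; congr nat_of_bool.
have eqc := eq_constant_on BB'.
by apply/asboolP/asboolP => -[v kv vB]; exists v => //; apply/eqc.
Qed.

End BlockCount.

(** * Type A general position *)

Section Ties.
Context {T : eqType} (x0 : T) (r : rel T).
Hypotheses (r_trans : transitive r) (r_anti : antisymmetric r).

Definition ties n (l : seq T) : {set 'I_n} :=
  [set i : 'I_n | (i.+1 < n)%N && (nth x0 l i == nth x0 l i.+1)]%SET.

(** In a sorted list equal entries are adjacent, so an entry that does not tie with its
successor is the last one with its value. *)
Lemma card_ties l : sorted r l -> (#|ties (size l) l| + size (undup l) = size l)%N.
Proof.
have -> : #|ties (size l) l| = (\sum_(0 <= i < size l)
    ((i.+1 < size l) && (nth x0 l i == nth x0 l i.+1)))%N.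
  rewrite -sum1_card big_mkord big_mkcond; apply: eq_bigr => i _.
  by rewrite inE; case: (_ && _).
elim: l => [|x l IH]; first by rewrite big_geq.
move=> xl; have /IH {IH} := path_sorted xl.
rewrite big_nat_recl //=.
have -> : x \in l = (1 < (size l).+1)%N && (x == nth x0 l 0).
  case: l xl => //= z l /andP[xz zl]; rewrite inE.
  case: eqVneq => //= xz' ; apply/negbTE/negP => xl; case/eqP: xz'.
  apply: r_anti; rewrite xz /=.
  by move: zl; rewrite path_sortedE // => /andP[/allP /(_ x xl)].
by case: (_ && _) => IH; rewrite -[in RHS]IH ?add1n ?add0n /= ?addSn ?addnS.
Qed.

End Ties.

Section Dual.
Context {R : realType} {d : nat}.
Implicit Types X : seq 'rV[R]_d.

(* Its transpose sends a form to its values on X, and is onto when X is free. *)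
Let mx X : 'M[R]_(size X, d) := \matrix_i X`_i.

Lemma mx_dotv X v i : (v *m (mx X)^T) 0 i = dotv v X`_i.
Proof. by rewrite !mxE; apply: eq_bigr => j _; rewrite !mxE. Qed.

Lemma free_row_free X : free X -> row_free (mx X).
Proof.
move=> fX; apply: inj_row_free => u; rewrite mulmx_sum_row => u0.
apply/rowP => i; rewrite mxE; apply: (elimT (@freeP _ _ _ (in_tuple X)) fX (fun i => u 0 i)) => /=.
by rewrite -[RHS]u0; apply: eq_bigr => j _; rewrite rowK.
Qed.

Lemma free_dual X : free X -> exists w, forall a, a \in X -> dotv w a = 1.
Proof.
move=> /free_row_free /row_freeP[B mB].
exists (const_mx 1 *m B^T) => a /(nthP 0)[i si <-].
rewrite -(mx_dotv _ (Ordinal si)) -mulmxA -trmx_mul mB trmx1 mulmx1.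
by rewrite mxE.
Qed.

Lemma free_sol_dim X : free X ->
  sol_dim (fun v => forall a, a \in X -> dotv v a = 0) (d - size X).
Proof.
move=> /free_row_free /row_freeP[B mB].
pose f := linfun (mulmxr (mx X)^T : 'rV[R]_d -> 'rV[R]_(size X)).
have imf : limg f = fullv.
  apply/vspaceP => u; rewrite memvf; apply/memv_imgP.
  exists (u *m B^T); rewrite ?memvf // lfunE /= -mulmxA -trmx_mul mB trmx1.
  by rewrite mulmx1.
exists (lker f).
  by have := limg_ker_dim f fullv; rewrite capfv imf !dimvf !dim_matrix !mul1r => /(congr1 (subn^~ (size X))); rewrite addnK.
move=> v; rewrite memv_ker lfunE /=; split=> [/eqP v0 a /(nthP 0)[i si <-]|v0].
  by rewrite -(mx_dotv _ (Ordinal si)) v0 mxE.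
by apply/eqP/rowP => i; rewrite mx_dotv mxE; apply: v0; apply: mem_nth.
Qed.

End Dual.

Section TypeA.
Context {R : realType} {d n : nat} (y : 'I_n -> 'rV[R]_d).
Hypothesis gy : type_A_general_position y.
Implicit Types (s : seq 'I_n) (J : {set 'I_n}).

Definition consecutive_differences s J : seq 'rV[R]_d :=
  [seq y (nth i s i) - y (nth i s i.+1) | i <- enum J].

(** General position is stated for exactly d positions, but at most d positions among
the n - 1 available ones can be completed to d. *)
Lemma extend_positions J : (forall i, i \in J -> (i.+1 < n)%N) -> (#|J| <= d)%N ->
  exists K : {set 'I_n}, [/\ [disjoint J & K]%B, forall i, i \in (J :|: K)%SET -> (i.+1 < n)%N
    & #|(J :|: K)%SET| = d].
Proof.
have [dn _] := gy => Jn Jd; pose V := [set i : 'I_n | (i.+1 < n)%N]%SET.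
have cV : #|V| = n.-1.
  have n0 : (n.-1 < n)%N by lia.
  have -> : V = (~: [set Ordinal n0])%SET.
    apply/setP => i; rewrite !inE -val_eqE /=; have := ltn_ord i; lia.
  by rewrite cardsC1 card_ord.
have JV : J \subset V by apply/fintype.subsetP => i /Jn; rewrite inE.
have : (d - #|J| <= #|(V :\: J)%SET|)%N.
  by rewrite cardsDS // cV; apply: leq_sub2r; lia.
move=> /card_geqP[l [ul sl lV]]; exists [set i in l]%SET.
have dJ : [disjoint J & [set i in l]%SET]%B.
  rewrite disjoint_sym disjoint_subset; apply/fintype.subsetP => i.
  by rewrite !inE => /lV; rewrite inE => /andP[].
split=> // [i|].
  by rewrite !inE => /orP[/Jn//|/lV]; rewrite !inE => /andP[_].
rewrite cardsU (disjoint_setI0 dJ) cards0 subn0 cardsE (card_uniqP ul) sl; lia.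
Qed.

Lemma free_consecutive_differences s J : perm_eq s (enum 'I_n) ->
  (forall i, i \in J -> (i.+1 < n)%N) -> (#|J| <= d)%N ->
  free (consecutive_differences s J).
Proof.
move=> sE Jn Jd; have [K [dJK JKn cJK]] := extend_positions Jn Jd.
have ss : size s = n by rewrite (perm_size sE) size_enum_ord.
have us : uniq s by rewrite (perm_uniq sE) enum_uniq.
have finj : injective (fun i : 'I_n => nth i s i).
  move=> i j /eqP; rewrite (set_nth_default i j) ?ss // nth_uniq ?ss //.
  by move/eqP/val_inj.
have := gy.2 (perm finj) _ JKn cJK.
have -> : [seq y (perm finj i) - y (perm finj (ordS i)) | i <- enum (J :|: K)%SET] =
          consecutive_differences s (J :|: K)%SET.
  apply/eq_in_map => i; rewrite mem_enum => /JKn iN.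
  by rewrite !permE (set_nth_default i (ordS i)) /= modn_small ?ss.
have pJK : perm_eq (enum (J :|: K)%SET) (enum J ++ enum K).
  apply: uniq_perm; rewrite ?cat_uniq ?enum_uniq //= ?andbT.
    apply/hasPn => x; rewrite !mem_enum => iK; apply/negP => iJ.
    by rewrite (disjointFr dJK iJ) in iK.
  by move=> i; rewrite mem_cat !mem_enum inE.
rewrite (perm_free (perm_map _ pJK)) map_cat; exact: catl_free.
Qed.

(** Along a list sorted by colours, equally coloured points are joined by a chain of
ties between neighbours. *)
Lemma colour_constant_ties (c : 'I_n -> nat) s v : perm_eq s (enum 'I_n) ->
  sorted leq (map c s) ->
  (forall a, a \in consecutive_differences s (ties 0%N n (map c s)) -> dotv v a = 0)
  <-> colour_constant y c (enum 'I_n) v.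
Proof.
move=> sE cs; have ss : size s = n by rewrite (perm_size sE) size_enum_ord.
have tiesE (i : 'I_n) : (i \in ties 0%N n (map c s)) =
    (i.+1 < n)%N && (c (nth i s i) == c (nth i s i.+1)).
  rewrite inE; case: ltnP => //= iN; by rewrite !(nth_map i) ?ss.
split=> [h|h a /mapP[i]]; last first.
  rewrite mem_enum tiesE => /andP[iN /eqP ci] ->; rewrite dotvBr; apply/eqP.
  by rewrite subr_eq0; apply/eqP; apply: h; rewrite ?mem_enum.
have step (i : 'I_n) k : (i + k < n)%N -> c (nth i s i) = c (nth i s (i + k)) ->
    dotv v (y (nth i s i)) = dotv v (y (nth i s (i + k))).
  elim: k => [|k IH]; first by rewrite addn0.
  move=> ikn cik.
  have le p q : (p <= q < n)%N -> (c (nth i s p) <= c (nth i s q))%N.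
    move=> /andP[pq qn].
    have := sorted_leq_nth leq_trans leqnn 0%N cs.
    move=> /(_ p q); rewrite !inE !size_map !ss => /(_ (leq_ltn_trans pq qn) qn pq).
    by rewrite !(nth_map i) ?ss //; lia.
  have c1 : c (nth i s i) = c (nth i s (i + k)).
    apply/eqP; rewrite eqn_leq le ?andTb; last lia.
    by rewrite cik le //; lia.
  rewrite IH //; last lia.
  have ikn' : (i + k < n)%N by lia.
  have /h : y (nth i s (i + k)) - y (nth i s (i + k.+1)) \in
      consecutive_differences s (ties 0%N n (map c s)).
    apply/mapP; exists (Ordinal ikn').
      rewrite mem_enum tiesE /= -addnS ikn !(set_nth_default i (Ordinal ikn')) ?ss //.
      by rewrite -c1 cik eqxx.
    by rewrite /= -addnS !(set_nth_default i (Ordinal ikn')) ?ss.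
  by rewrite dotvBr => /eqP; rewrite subr_eq0 => /eqP.
have main a b : (index a s <= index b s)%N -> c a = c b ->
    dotv v (y a) = dotv v (y b).
  have aS x : x \in s by rewrite (perm_mem sE) mem_enum.
  have an x : (index x s < n)%N by rewrite -[X in (_ < X)%N]ss index_mem.
  move=> ab; have := step (Ordinal (an a)) (index b s - index a s)%N.
  by rewrite /= subnKC // !nth_index //; apply.
move=> a b _ _ cab; have [ab|/ltnW ba] := leqP (index a s) (index b s).
  exact: main.
by symmetry; apply: main.
Qed.

(** After sorting the points by colours, the equations become consecutive
differences, which are free as long as there are at most d of them.  If there are
more, already d of them force the form to vanish. *)
Lemma generic_type_A : generic y (fun=> True) d (enum 'I_n).
Proof.
move=> c; rewrite size_enum_ord.
pose s := sort (fun a b => c a <= c b)%N (enum 'I_n).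
have sE : perm_eq s (enum 'I_n) by rewrite perm_sort.
have cs : sorted leq (map c s).
  by rewrite sorted_map; apply: sort_sorted => a b; apply: leq_total.
have ss : size (map c s) = n by rewrite size_map (perm_size sE) size_enum_ord.
have ct := card_ties 0%N leq_trans anti_leq cs; rewrite ss in ct.
have -> : size (undup (map c (enum 'I_n))) = size (undup (map c s)).
  by apply: perm_size; apply: perm_undup => i; apply: perm_mem; rewrite perm_map // perm_sym.
have tn J i : J \subset ties 0%N n (map c s) -> i \in J -> (i.+1 < n)%N.
  by move=> /fintype.subsetP /[apply]; rewrite inE => /andP[].
have ctE v : (forall a, a \in consecutive_differences s (ties 0%N n (map c s)) ->
    dotv v a = 0) <-> (True /\ colour_constant y c (enum 'I_n) v).
  by rewrite (colour_constant_ties v sE cs); tauto.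
have [td|td] := leqP #|ties 0%N n (map c s)| d.
  apply: (sol_dim_ext ctE); rewrite (_ : (n - _)%N = #|ties 0%N n (map c s)|); last lia.
  have := free_sol_dim (free_consecutive_differences sE (fun i => tn _ i (subxx _)) td).
  by rewrite size_map -cardE.
have [l [ul sl lt]] := card_geqP (ltnW td).
have tl : [set i in l]%SET \subset ties 0%N n (map c s).
  by apply/fintype.subsetP => i; rewrite inE; apply: lt.
have cl : #|[set i in l]%SET| = d by rewrite cardsE (card_uniqP ul).
have := free_sol_dim (free_consecutive_differences sE (fun i => tn _ i tl) (eq_leq cl)).
rewrite size_map -cardE cl subnn => s0.
rewrite (_ : (d - _)%N = 0%N); last lia.
apply: (sol_dim_ext ctE); apply: (sol_dim_ext _ s0) => v; split=> h; last first.
  move=> a /mapP[i]; rewrite mem_enum => il ->; apply: h; apply/mapP; exists i => //.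
  by rewrite mem_enum; apply: (fintype.subsetP tl).
have -> : v = 0 by apply: (sol_dim0 s0).
by move=> a _; rewrite dotv0l.
Qed.

(** At least n - d distinct values means at most d ties.  The corresponding consecutive
differences are free, so some w takes the value 1 on all of them; adding a small
multiple of w to v breaks every tie in the direction of s. *)
Lemma realizable_of_weakly_sorted s v : perm_eq s (enum 'I_n) ->
  sorted (fun a b => dotv v (y b) <= dotv v (y a)) s ->
  (n - d <= size (undup [seq dotv v (y a) | a <- s]))%N ->
  realizable y (fun=> True) s.
Proof.
move=> sE vs dn.
have ss : size s = n by rewrite (perm_size sE) size_enum_ord.
pose l := [seq dotv v (y a) | a <- s].
have sl : size l = n by rewrite size_map.
have ls : sorted (fun a b : R => b <= a) l by rewrite sorted_map.
have := card_ties 0 (rev_trans le_trans) _ ls; rewrite sl => ct.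
have {ct}td : (#|ties 0%R n l| <= d)%N.
  have [dn' _] := gy; rewrite -/l in dn.
  have {}ct := ct (fun a b h => le_anti (etrans (andbC _ _) h)).
  by rewrite -(leq_add2r (size (undup l))) ct -leq_subLR.
have tn i : i \in ties 0%R n l -> (i.+1 < n)%N by rewrite inE => /andP[].
have [w hw] := free_dual (free_consecutive_differences sE tn td).
have [e e0 he] := perturb_gt y s v w.
exists (v + e *: w) => //.
suff H (x0 : 'I_n) : realizes y (v + e *: w) s.
  by move: H; case: (s) => // x0 s'; apply.
apply/(sortedP x0) => i si.
have siS : (i.+1 < n)%N by move: si; rewrite ss.
have si' : (i < n)%N by exact: ltnW.
have := sortedP x0 vs i si; rewrite le_eqVlt => /orP[/eqP vi|vi]; last first.
  by apply: he => //; apply: mem_nth => //; apply: ltnW.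
rewrite !dotvDl !dotvZl.
have : y (nth x0 s i) - y (nth x0 s i.+1) \in consecutive_differences s (ties 0%R n l).
  apply/mapP; exists (Ordinal si').
    by rewrite mem_enum inE /= siS !(nth_map x0) ?vi ?ss ?eqxx.
  by rewrite /= !(set_nth_default x0 (Ordinal si')) ?ss.
by move=> /hw; rewrite dotvBr vi => /eqP; rewrite subr_eq => /eqP ->; nra.
Qed.

End TypeA.

(** * Faces of a chamber *)

Section Runs.
Context {K : eqType} {T : eqType} (x0 : T).
Implicit Types (g : T -> K) (s b : seq T) (B : seq (seq T)).

(** Maximal runs of neighbours with equal g: the list of blocks that a form cuts out of
a list along which it is decreasing. *)
Definition runs g s : seq (seq T) :=
  foldr (fun a B => if B is (c :: b) :: B' then
                      if g a == g c then (a :: c :: b) :: B' else [:: a] :: B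
                    else [:: a] :: B) [::] s.

Lemma runs_cons g a s : runs g (a :: s) =
  if runs g s is (c :: b) :: B' then
    if g a == g c then (a :: c :: b) :: B' else [:: a] :: runs g s
  else [:: a] :: runs g s.
Proof. by []. Qed.

Lemma flatten_runs g s : flatten (runs g s) = s.
Proof.
elim: s => // a s; rewrite runs_cons.
by case: (runs g s) => [|[|c b] B] /=; [move=> <-|move=> ->|case: ifP => _ /= ->].
Qed.

Lemma runs_nonempty g s : [::] \notin runs g s.
Proof.
elim: s => // a s; rewrite runs_cons.
by case: (runs g s) => [|[|c b] B] //=; case: ifP.
Qed.

Lemma runs_constant g s b a : b \in runs g s -> a \in b -> g a = g (head x0 b).
Proof.
elim: s b a => // i s IH b a; rewrite runs_cons.
case: (runs g s) IH => [|[|c b'] B] IH.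
- by rewrite inE => /eqP ->; rewrite inE => /eqP ->.
- rewrite inE => /predU1P[->|]; last exact: IH.
  by rewrite inE => /eqP ->.
case: ifP => [/eqP ic|_]; rewrite inE => /predU1P[->|bB].
- rewrite inE => /predU1P[->//|ab] /=; rewrite ic.
  by apply: (IH (c :: b')) => //; rewrite mem_head.
- by apply: IH; rewrite inE bB orbT.
- by rewrite inE => /eqP ->.
- exact: IH.
Qed.

Lemma runsK g B : [::] \notin B ->
  (forall b a, b \in B -> a \in b -> g a = g (head x0 b)) ->
  sorted (fun b b' => g (head x0 b) != g (head x0 b')) B ->
  runs g (flatten B) = B.
Proof.
elim: B => // b B IH; rewrite inE negb_or => /andP[nb nB] cB sB /=.
have {IH} := IH nB (fun b' a b'B => cB b' a (mem_behead (s := b :: B) b'B)) (path_sorted sB).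
have := cB b ^~ (mem_head _ _); move: (flatten B) => s {cB} cb.
case: b nb sB cb => // a b _; elim: b a => [|a' b IH] a sB cb rB.
  rewrite /= rB; case: B nB sB rB => //= -[|c b'] B //= _ /andP[ac _] _.
  by rewrite (negPf ac).
have e1 : g a' = g a := cb a' (mem_behead (s := a :: a' :: b) (mem_head _ _)).
rewrite cat_cons runs_cons IH /=.
- by rewrite e1 eqxx.
- by case: (B) sB => //= b' B' /andP[h ->]; rewrite /= e1 h.
- by move=> c cb' /=; rewrite e1 cb // inE cb' orbT.
- by [].
Qed.

End Runs.

Lemma eq_runs (K K' T : eqType) (g : T -> K) (g' : T -> K') s :
  {in s &, forall a b, (g a == g b) = (g' a == g' b)} -> runs g' s = runs g s.
Proof.
elim: s => // a s IH gg; rewrite !runs_cons IH; last first.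
  by move=> b c bs cs; apply: gg; rewrite inE ?bs ?cs orbT.
have := flatten_runs g s; case: (runs g s) => [|[|c b] B] //= e1.
by rewrite gg ?inE ?eqxx // -e1 /= mem_head orbT.
Qed.

Lemma card_fset_set_seq (T : choiceType) (A : set T) (l : seq T) :
  uniq l -> (forall x, A x <-> x \in l) -> #|` fset_set A|%fset = size l.
Proof.
move=> ul Al; have -> : A = [set` [fset x in l]%fset].
  by apply/seteqP; split=> x /=; rewrite inE => /Al.
by rewrite set_fsetK card_fseq undup_id.
Qed.

Section Faces.
Context {R : realType} {d n : nat} (x0 : 'I_n) (y : 'I_n -> 'rV[R]_d).
Hypothesis gy : type_A_general_position y.
Implicit Types (s : seq 'I_n) (B : seq (seq 'I_n)) (u v w : 'rV[R]_d).

Local Notation E := (enum 'I_n).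
Local Notation bp := (block_point x0 y).
Local Notation const := (constant_on x0 y).

Definition weak_cone s : set 'rV[R]_d :=
  [set v | sorted (fun a b => dotv v (y b) <= dotv v (y a)) s].

Definition face_of B : set 'rV[R]_d :=
  [set v | weak_cone (flatten B) v /\ const B v].

Lemma weak_trans v : transitive (fun a b => dotv v (y b) <= dotv v (y a)).
Proof. by move=> b a c ab bc; apply: le_trans bc ab. Qed.

(** The redundant description by all pairs makes the ties of a form linear equations
between arbitrary points, instead of neighbours only. *)
Lemma weak_coneP s v : uniq s -> weak_cone s v <->
  (forall a b, a \in s -> b \in s -> (index a s < index b s)%N ->
     dotv v (y b) <= dotv v (y a)).
Proof.
move=> us; split=> [vs a b aS bS ab|h].
  exact: (sorted_ltn_index (@weak_trans v) vs).
apply/(sortedP x0) => i si; have si' := ltnW si.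
by apply: h; rewrite ?mem_nth // !index_uniq.
Qed.

Section Witness.
Variables (B : seq (seq 'I_n)) (v : 'rV[R]_d).
Hypothesis uB : uniq (flatten B).
Hypotheses (cB : const B v) (rB : realizes bp v B).

(** Strict decrease between blocks makes points with equal values at v lie in the same
block, where every form constant on the blocks has equal values. *)
Lemma same_block a a' : a \in flatten B -> a' \in flatten B ->
  dotv v (y a) = dotv v (y a') -> forall u, const B u -> dotv u (y a) = dotv u (y a').
Proof.
move=> /flattenP[b bB ab] /flattenP[b' bB' ab'].
rewrite (cB bB ab) (cB bB' ab') => e1 u cu; rewrite (cu b) // (cu b') //.
have lt := sorted_ltn_index (@gt_dotv_trans _ _ _ bp v) rB.
have [ib|ib|ib] := ltngtP (index b B) (index b' B).
- by have := lt _ _ bB bB' ib; rewrite e1 ltxx.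
- by have := lt _ _ bB' bB ib; rewrite e1 ltxx.
- by rewrite -(nth_index [::] bB) ib nth_index.
Qed.

Lemma weak_cone_witness : weak_cone (flatten B) v.
Proof.
rewrite /weak_cone /= (sorted_pairwise (@weak_trans v)).
move: cB rB; rewrite /realizes (sorted_pairwise (@gt_dotv_trans _ _ _ bp v)) /=.
elim: B => //= b B' IH cb /andP[/allP bB' pB'].
have cB' : const B' v by move=> b' a h; apply: cb; rewrite inE h orbT.
have cbb a : a \in b -> dotv v (y a) = dotv v (bp b) by apply: cb; rewrite mem_head.
rewrite pairwise_cat IH // andbT; apply/andP; split.
  apply/allrelP => a a' ab /flattenP[b' b'B' ab'].
  by rewrite (cbb _ ab) (cB' _ _ b'B' ab') ltW ?bB'.
apply/(pairwiseP x0) => i j ib jb _.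
by rewrite (cbb _ (mem_nth x0 ib)) (cbb _ (mem_nth x0 jb)).
Qed.

(** A witness v lies in the relative interior of its face, so that the face spans the
space of forms constant on the blocks. *)
Lemma face_perturb u : const B u ->
  exists2 e : R, 0 < e & face_of B (v + e *: u).
Proof.
move=> cu; set s := flatten B.
have [e e0 he] := perturb_gt y s v u; exists e => //; split; last first.
  by move=> b a bB ab; rewrite !dotvDl !dotvZl (cB bB ab) (cu b a bB ab).
apply/weak_coneP => // a b aS bS ab.
have := (weak_coneP v uB).1 weak_cone_witness a b aS bS ab.
rewrite le_eqVlt => /predU1P[vab|vab]; last exact/ltW/he.
by rewrite !dotvDl !dotvZl vab (same_block bS aS vab cu).
Qed.

Lemma face_of_witness : face_of B v.
Proof. by split; first exact: weak_cone_witness. Qed.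

End Witness.

Lemma has_dim_uniq (F : set 'rV[R]_d) k k' : has_dim F k -> has_dim F k' -> k = k'.
Proof.
move=> [U <- [FU hU]] [V <- [FV hV]].
by apply/eqP; rewrite eqn_leq !dimvS ?hU ?hV.
Qed.

Lemma has_dim_face_of B v : block_list E B -> const B v -> realizes bp v B ->
  has_dim (face_of B) (d - (n - size B)).
Proof.
move=> bB cB rB; have /andP[nB pB] := bB.
have uB : uniq (flatten B) by rewrite (perm_uniq pB) enum_uniq.
have gB := generic_blocks x0 (enum_uniq _) (generic_type_A gy) bB.
have := generic_dim (uniq_block_list (enum_uniq _) bB) gB; rewrite size_enum_ord.
move=> [U dU hU]; exists U => //; split=> [u [_ /hU //]|V FV].
apply/subvP => u /hU cu; have [e e0 /FV /= eu] := face_perturb uB cB rB cu.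
have := FV _ (face_of_witness cB rB) => /= vV.
have : e *: u \in V by rewrite -(addKr v (e *: u)) rpredD // rpredN.
by move=> h; rewrite -[u](scalerK (lt0r_neq0 e0)) memvZ.
Qed.

(** A sum of points of F vanishes on a vector of l only if all of them do; adding up one
point for each vector of l on which F does not vanish identically gives v. *)
Lemma generic_point (F : set 'rV[R]_d) (l : seq 'rV[R]_d) : F 0 ->
  (forall u v, F u -> F v -> F (u + v)) ->
  (forall a u, a \in l -> F u -> 0 <= dotv u a) ->
  exists2 v, F v & forall a, a \in l -> dotv v a = 0 -> forall u, F u -> dotv u a = 0.
Proof.
move=> F0 FD; elim: l => [|a l IH] Fl; first by exists 0.
have [|v Fv hv] := IH; first by move=> b u bl; apply: Fl; rewrite inE bl orbT.
have [[u Fu ua]|nu] := pselect (exists2 u, F u & dotv u a <> 0); last first.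
  exists v => // b; rewrite inE => /predU1P[->|bl] e1 u Fu; last exact: hv e1 u Fu.
  by apply: contrapT => ua; apply: nu; exists u.
exists (v + u); first exact: FD.
move=> b bl; have v0 := Fl b v bl Fv; have u0 := Fl b u bl Fu.
rewrite dotvDl => e1; have ve : dotv v b = 0 by lra.
have ue : dotv u b = 0 by lra.
by move: bl; rewrite inE => /predU1P[ba|bl]; [rewrite -ba ue in ua|exact: hv].
Qed.

Lemma face_sub C F : is_face C F -> exists s t : seq 'rV[R]_d,
  [/\ {subset t <= s}, C = polycone s &
      forall v, F v <-> C v /\ forall a, a \in t -> dotv v a = 0].
Proof.
move=> [s [t [_ ts -> ->]]]; exists s, t; split=> // v; split=> [[h1 h2]|[h1 h2]].
  split=> [a aS|a /h2 //]; have [at'|at'] := boolP (a \in t).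
    by rewrite (h2 a at').
  by apply: h1; rewrite mem_filter at'.
by split=> [a|a /h2//]; rewrite mem_filter => /andP[_ /h1].
Qed.

Lemma realizes_runs s v : weak_cone s v ->
  realizes bp v (runs (fun a => dotv v (y a)) s).
Proof.
rewrite /weak_cone /=; elim: s => // a s IH vas.
have {IH} := IH (path_sorted vas); rewrite runs_cons.
have := flatten_runs (fun a => dotv v (y a)) s.
have := runs_nonempty (fun a => dotv v (y a)) s.
case: (runs _ s) => [|[|c b] B] //= _ fB.
case: eqP => [vac|/eqP vac] cB.
  by case: B cB {fB} => //= b' B /andP[+ ->]; rewrite /block_point /= vac => ->.
rewrite /realizes /= cB andbT /block_point /= lt_neqAle eq_sym vac /=.
by move: vas; rewrite -fB /= => /andP[].
Qed.

(** Let v be a point of F with as few ties as possible and B its blocks.  A form u in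
the face of B can be subtracted from v in a small multiple without leaving the
cone.  So on a vector a whose half-space contains the cone and whose boundary
contains v, the form u is both nonnegative and nonpositive: u lies in F.  The
argument uses only that the half-spaces cut out the cone, and thus applies to every
representation. *)
Lemma face_is_face_of s F : perm_eq s E -> is_face (weak_cone s) F ->
  exists B v, [/\ block_list E B, flatten B = s, const B v, realizes bp v B &
                  F = face_of B].
Proof.
move=> sE /face_sub[s' [t [ts Cs Fe]]].
have us : uniq s by rewrite (perm_uniq sE) enum_uniq.
have F0 : F 0.
  by apply/Fe; rewrite Cs; split=> a _; rewrite dotv0l.
have FD u v : F u -> F v -> F (u + v).
  move=> /Fe[Cu tu] /Fe[Cv tv]; apply/Fe; split; last first.
    by move=> a at'; rewrite dotvDl tu ?tv ?addr0.
  rewrite Cs in Cu Cv *; move=> a aS; rewrite dotvDl addr_ge0 //; [exact: Cu|exact: Cv].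
pose l := [seq y a.1 - y a.2 | a <- allpairs pair s s & (index a.1 s < index a.2 s)%N].
have Fl a u : a \in l -> F u -> 0 <= dotv u a.
  move=> /mapP[[i j]]; rewrite mem_filter /= => /andP[ij /allpairsP[[? ?] /= [iS jS]]].
  move=> [ei ej] ->; move: ij; rewrite ei ej => ij.
  by move=> /Fe[/(weak_coneP _ us) h _]; rewrite dotvBr subr_ge0; apply: h.
have [v Fv hv] := generic_point F0 FD Fl.
have /Fe[Cv tv] := Fv.
pose g a := dotv v (y a); pose B := runs g s.
have fB : flatten B = s := flatten_runs g s.
have nB : [::] \notin B := runs_nonempty g s.
have cB : const B v by move=> b a; apply: runs_constant.
have uB : uniq (flatten B) by rewrite fB.
have rB : realizes bp v B := realizes_runs Cv.
exists B, v; split=> //.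
  by rewrite /block_list nB fB.
apply/seteqP; split=> u.
  move=> Fu; have /Fe[Cu _] := Fu; split; first by rewrite fB.
  have tie i j : i \in s -> j \in s -> g i = g j -> (index i s < index j s)%N ->
      dotv u (y i) = dotv u (y j).
    move=> iS jS gij ij; apply/eqP; rewrite -subr_eq0 -dotvBr; apply/eqP.
    apply: hv => //; last by rewrite dotvBr -/(g i) -/(g j) gij subrr.
    apply/mapP; exists (i, j) => //; rewrite mem_filter ij.
    by apply/allpairsP; exists (i, j).
  move=> b a bB ab; have gab := cB _ _ bB ab.
  have aS : a \in s by rewrite -fB; apply/flattenP; exists b.
  have hb := mem_head_block x0 nB bB.
  have hS : head x0 b \in s by rewrite -fB; apply/flattenP; exists b.
  have [ib|ib|ib] := ltngtP (index a s) (index (head x0 b) s).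
  - exact: tie.
  - by symmetry; apply: tie.
  - by rewrite /block_point -(nth_index x0 aS) ib nth_index.
move=> [Cu cu]; rewrite fB in Cu; apply/Fe; split=> // a at'.
have cNu : const B (- u) by move=> b i bB ib; rewrite !dotvNl (cu b i bB ib).
have [e e0 [Cw _]] := face_perturb uB cB rB cNu.
rewrite fB Cs in Cw; rewrite Cs in Cu.
have := Cw a (ts a at'); have := Cu a (ts a at').
rewrite dotvDl dotvZl dotvNl tv // add0r mulrN oppr_ge0 pmulr_rle0 // => h1 h2.
by apply/eqP; rewrite eq_le h1 h2.
Qed.

(** The representation by the differences of all pairs of points exhibits the face;
realizability of s serves to see that none of these differences vanishes. *)
Lemma is_face_face_of s B v : perm_eq s E -> realizable y (fun=> True) s ->
  flatten B = s -> [::] \notin B -> const B v -> realizes bp v B ->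
  is_face (weak_cone s) (face_of B).
Proof.
move=> sE [x _ xs] fB nB cB rB.
have us : uniq s by rewrite (perm_uniq sE) enum_uniq.
have uB : uniq (flatten B) by rewrite fB.
pose l := [seq a <- allpairs pair s s | (index a.1 s < index a.2 s)%N].
pose df (a : 'I_n * 'I_n) := y a.1 - y a.2.
have lP i j : (i, j) \in l <-> [/\ i \in s, j \in s & (index i s < index j s)%N].
  rewrite mem_filter; split=> [/andP[ij /allpairsP[[? ?] /= [iS jS [ei ej]]]]|[iS jS ij]].
    by move: ij; rewrite ei ej.
  by rewrite ij; apply/allpairsP; exists (i, j).
have Cs w : weak_cone s w <-> forall i j, (i, j) \in l -> 0 <= dotv w (y i - y j).
  rewrite weak_coneP //; split=> h i j.
    by move=> /lP[iS jS ij]; rewrite dotvBr subr_ge0; apply: h.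
  by move=> iS jS ij; rewrite -subr_ge0 -dotvBr; apply: h; apply/lP.
exists (map df l), (map df [seq a <- l | dotv v (y a.1) == dotv v (y a.2)]).
have tP a : a \in map df [seq a <- l | dotv v (y a.1) == dotv v (y a.2)] ->
    exists i j, [/\ (i, j) \in l, dotv v (y i) = dotv v (y j) & a = y i - y j].
  by move=> /mapP[[i j]]; rewrite mem_filter /= => /andP[/eqP vij ijl] ->; exists i, j.
split.
- apply/mapP => -[[i j] /lP[iS jS ij]] /(congr1 (dotv x)).
  have := sorted_ltn_index (@gt_dotv_trans _ _ _ y x) xs _ _ iS jS ij.
  by rewrite /df dotvBr [LHS]dotvC dotv0l /= => h; lra.
- by move=> ? /mapP[a]; rewrite mem_filter => /andP[_ al] ->; apply: map_f.
- apply/seteqP; split=> w.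
    by move=> /Cs h ? /mapP[[i j] ijl ->]; apply: h.
  by move=> h; apply/Cs => i j ijl; apply: h; apply: map_f ijl.
apply/seteqP; split=> w.
  move=> [Cw cw]; rewrite fB in Cw; split=> [a|a /=].
    by rewrite mem_filter => /andP[_ /mapP[[i j] ijl ->]]; apply: (Cs w).1.
  move=> /tP[i [j [/lP[iS jS _] vij ->]]]; rewrite /orthv /= dotvBr.
  by rewrite (same_block cB rB _ _ vij cw) ?fB ?subrr.
move=> [h1 h2].
have tie i j : (i, j) \in l -> dotv v (y i) = dotv v (y j) -> dotv w (y i) = dotv w (y j).
  move=> ijl vij; apply/eqP; rewrite -subr_eq0 -dotvBr; apply/eqP; apply: h2 => /=.
  by apply/mapP; exists (i, j) => //; rewrite mem_filter ijl vij eqxx.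
split.
  rewrite fB; apply/Cs => i j ijl.
  have [/tP[i' [j' [ijl' vij' ->]]]|nt] := boolP (y i - y j \in map df [seq a <- l | dotv v (y a.1) == dotv v (y a.2)]).
    by rewrite dotvBr (tie i' j') ?subrr.
  by apply: h1; rewrite mem_filter nt; apply: map_f ijl.
move=> b a bB ab; have vab := cB _ _ bB ab.
have aS : a \in s by rewrite -fB; apply/flattenP; exists b.
have hb := mem_head_block x0 nB bB.
have hS : head x0 b \in s by rewrite -fB; apply/flattenP; exists b.
have [ib|ib|ib] := ltngtP (index a s) (index (head x0 b) s).
- by apply: tie => //; apply/lP.
- by symmetry; apply: tie => //; apply/lP.
- by rewrite /block_point -(nth_index x0 aS) ib nth_index.
Qed.

(** The blocks are recovered from the ties of any witness, and each witness has all
the ties of the other one. *)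
Lemma face_of_inj B B' v v' : flatten B = flatten B' -> uniq (flatten B) ->
  [::] \notin B -> const B v -> realizes bp v B ->
  [::] \notin B' -> const B' v' -> realizes bp v' B' ->
  face_of B = face_of B' -> B = B'.
Proof.
move=> fBB' uB nB cB rB nB' cB' rB' FF.
have uB' : uniq (flatten B') by rewrite -fBB'.
have [_ cBv'] : face_of B v' by rewrite FF; apply: face_of_witness.
have [_ cB'v] : face_of B' v by rewrite -FF; apply: face_of_witness.
have runsB B1 w : [::] \notin B1 -> const B1 w -> realizes bp w B1 ->
    runs (fun a => dotv w (y a)) (flatten B1) = B1.
  move=> nB1 cB1 rB1; apply: (runsK (x0 := x0)) => //.
  by apply: sub_sorted rB1 => b b' /gt_eqF ->.
rewrite -(runsB B v) // -(runsB B' v') // -fBB'; symmetry; apply: eq_runs.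
move=> a b aB bB; apply/eqP/eqP => e1.
  exact: (same_block cB rB aB bB e1).
by apply: (same_block cB' rB' _ _ e1); rewrite -?fBB'.
Qed.

End Faces.

(** * Summing the face numbers over the orders *)

Section NumFaces.
Context {R : realType} {d n : nat} (x0 : 'I_n) (y : 'I_n -> 'rV[R]_d).
Hypothesis gy : type_A_general_position y.
Implicit Types (s : seq 'I_n) (B : seq (seq 'I_n)) (v : 'rV[R]_d).

Local Notation E := (enum 'I_n).

(** Since k is positive, dimension k determines the number of blocks, although the
subtraction in the dimension of a face is truncated. *)
Lemma num_faces_weak_cone k (L : seq (seq (seq 'I_n))) s :
  (1 <= k <= d)%N -> uniq L ->
  (forall B, (B \in L) = block_list E B && (size B == (n - d + k)%N)) ->
  perm_eq s E -> realizable y (fun=> True) s ->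
  num_faces k (weak_cone y s) =
  (\sum_(B <- L | flatten B == s) `[<face_realizable x0 y B>])%N.
Proof.
move=> /andP[k1 kd] uL LE sE rs; have [dn _] := gy.
have us : uniq s by rewrite (perm_uniq sE) enum_uniq.
pose L' := [seq B <- L | (flatten B == s) && `[<face_realizable x0 y B>]].
have L'P B : B \in L' -> [/\ block_list E B, [::] \notin B, flatten B = s,
    size B = (n - d + k)%N & exists2 v, constant_on x0 y B v &
    realizes (block_point x0 y) v B].
  rewrite mem_filter LE => /andP[/andP[/eqP fB /asboolP wB] /andP[bB /eqP sB]].
  by have /andP[nB _] := bB.
rewrite /num_faces (@card_fset_set_seq _ _ [seq face_of x0 y B | B <- L']).
- rewrite size_map size_filter -sum1_count [RHS]big_mkcond [LHS]big_mkcond /=.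
  by apply: eq_bigr => B _; case: eqP => //= _; case: asboolP.
- rewrite map_inj_in_uniq ?filter_uniq // => B B'.
  move=> /L'P[_ nB fB _ [v cB rB]] /L'P[_ nB' fB' _ [v' cB' rB']] FF.
  by apply: (face_of_inj _ _ nB cB rB nB' cB' rB' FF); rewrite fB.
move=> F; split=> [[/= Ff Fk]|/mapP[B]].
  have [B [v [bB fB cB rB FB]]] := face_is_face_of x0 sE Ff.
  apply/mapP; exists B => //; rewrite mem_filter fB eqxx /= LE bB /=.
  apply/andP; split; first by apply/asboolP; exists v.
  rewrite FB in Fk; have h1 := has_dim_uniq Fk (has_dim_face_of gy bB cB rB).
  have := size_block_list bB; rewrite size_enum_ord => h2; apply/eqP.
  by move: h1 h2; move: (size B) => m; lia.
move=> /L'P[bB nB fB sB [v cB rB]] ->; split.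
  exact: (is_face_face_of sE rs fB nB cB rB).
have := has_dim_face_of gy bB cB rB; rewrite sB.
by have -> : (d - (n - (n - d + k)) = k)%N by lia.
Qed.

(** With n - d + k blocks a witness takes that many distinct values. *)
Lemma realizable_flatten k B : (1 <= k)%N -> block_list E B ->
  size B = (n - d + k)%N -> face_realizable x0 y B ->
  realizable y (fun=> True) (flatten B).
Proof.
move=> k1 bB sB [v cB rB]; have /andP[nB pB] := bB.
apply: (realizable_of_weakly_sorted gy pB).
  exact: (weak_cone_witness cB rB).
apply: (@leq_trans (size [seq dotv v (block_point x0 y b) | b <- B])).
  by rewrite size_map sB; lia.
apply: uniq_leq_size.
  apply: (@sorted_uniq _ (fun a b : R => b < a)).
  - by move=> a b c ab bc; apply: lt_trans bc ab.
  - by move=> a; rewrite ltxx.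
  - by rewrite sorted_map.
move=> r /mapP[b bB' ->]; rewrite mem_undup /block_point; apply: map_f.
by apply/flattenP; exists b => //; apply: (mem_head_block x0 nB).
Qed.

(** A pair of a chamber and a k-face of it is the same as a realized list of blocks,
whose concatenation gives the chamber; the sum thus counts the realized lists. *)
Lemma sum_num_faces k : (1 <= k <= d)%N ->
  ((n - d + k)`! * \sum_(s <- permutations E | `[<realizable y (fun=> True) s>])
     num_faces k (weak_cone y s) =
   n`! * 'C(n.-1, d - k) * DA (n - d + k) k)%N.
Proof.
move=> /[dup] kd /andP[k1 kd']; have [dn _] := gy.
have [m em] : exists m, (n - d + k)%N = m.+2 by exists (n - d + k - 2)%N; lia.
have en : n = (m.+2 + (d - k))%N by lia.
have sE : size E = (m.+2 + (d - k))%N by rewrite size_enum_ord.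
have [L [uL LE cL]] := face_realizable_count x0 (enum_uniq _) sE (generic_type_A gy).
have n1 : (m.+1 + (d - k))%N = n.-1 by lia.
move: cL; rewrite size_enum_ord subKn // n1 -bin_sub; last lia.
rewrite (_ : n.-1 - m.+1 = d - k)%N; last lia.
rewrite -em => <-; rewrite -em in LE; congr muln.
transitivity (\sum_(s <- permutations E | `[<realizable y (fun=> True) s>])
    \sum_(B <- L | flatten B == s) `[<face_realizable x0 y B>])%N.
  rewrite big_seq_cond [RHS]big_seq_cond; apply: eq_bigr => s.
  rewrite mem_permutations => /andP[pE /asboolP rs].
  exact: num_faces_weak_cone.
rewrite (exchange_big_dep predT) //=; apply: eq_big_seq => B.
rewrite LE => /andP[bB /eqP sB]; have /andP[_ pB] := bB.
have [rB|nrB] := asboolP (face_realizable x0 y B); last first.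
  by rewrite big1.
rewrite (eq_bigr (fun=> 1%N)) // sum1_count (@eq_count _ _ (pred1 (flatten B))).
  by rewrite count_uniq_mem ?permutations_uniq // mem_permutations pB.
move=> s /=; rewrite [RHS]eq_sym; case: eqP => [<-|]; last by rewrite andbF.
by rewrite andbT; apply/asboolP; apply: realizable_flatten sB rB.
Qed.

End NumFaces.

(** * The tessellation *)

Section Tessellation.
Context {R : realType} {d n : nat} (x0 : 'I_n) (y : 'I_n -> 'rV[R]_d).
Implicit Types (s : seq 'I_n) (v x : 'rV[R]_d).

Local Notation E := (enum 'I_n).

Lemma continuous_dotv (a : 'rV[R]_d) : continuous (fun v => dotv v a).
Proof.
apply: continuous_big => [|j _ v]; first exact: add_continuous.
by apply: cvgMr_tmp; [exact: mx_nbhs_filter|exact: coord_continuous].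
Qed.

Lemma continuous_ray v w : continuous (fun t : R => v + t *: w).
Proof. by move=> t; apply: cvgD; [exact: cvg_cst|apply: cvgZr_tmp; exact: cvg_id]. Qed.

Lemma weyl_chambers_realizes x s : perm_eq s E -> realizes y x s ->
  weyl_chambers y x.
Proof.
move=> sE xs [[i j] /= ij]; rewrite /orthv /= dotvBr => e1.
have iS a : a \in s by rewrite (perm_mem sE) mem_enum.
have lt := sorted_ltn_index (@gt_dotv_trans _ _ _ y x) xs.
have [ib|ib|ib] := ltngtP (index i s) (index j s).
- by have := lt _ _ (iS i) (iS j) ib; lra.
- by have := lt _ _ (iS j) (iS i) ib; lra.
- by move: ij; rewrite -(nth_index x0 (iS i)) ib nth_index // ltnn.
Qed.

Lemma realizes_sort x : weyl_chambers y x ->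
  exists2 s, perm_eq s E & realizes y x s.
Proof.
move=> cx; pose r a b := dotv x (y b) <= dotv x (y a).
have rt : total r by move=> a b; apply: le_total.
exists (sort r E); first by rewrite perm_sort.
have us : uniq (sort r E) by rewrite sort_uniq enum_uniq.
apply/(sortedP x0) => i si; have si' := ltnW si.
have := sortedP x0 (sort_sorted rt E) i si; rewrite {1}/r le_eqVlt => /predU1P[e1|//].
exfalso; set a := nth _ _ i in e1; set b := nth _ _ i.+1 in e1.
have ab : a != b by rewrite nth_uniq //; apply/eqP; lia.
have [h|h|h] := ltngtP a b; last by rewrite (val_inj h) eqxx in ab.
- by apply: cx; exists (a, b) => //; rewrite /orthv /= dotvBr e1 subrr.
- by apply: cx; exists (b, a) => //; rewrite /orthv /= dotvBr e1 subrr.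
Qed.

(** The value of a form on a difference of points cannot change sign on a connected
set that avoids the hyperplanes; conversely, forms that realize the same order are
joined by a segment of such forms. *)
Lemma connected_component_chamber x s : perm_eq s E -> realizes y x s ->
  connected_component (weyl_chambers y) x = [set v | realizes y v s].
Proof.
move=> sE xs; apply/seteqP; split=> [v [D [Dx DW cD] Dv]|v vs] /=.
  apply/(sortedP x0) => i si; have si' := ltnW si.
  set a := nth _ _ i; set b := nth _ _ i.+1.
  have xab : dotv x (y b) < dotv x (y a) by exact: (sortedP x0 xs).
  rewrite ltNge; apply/negP => vab.
  have cf : {within D, continuous (fun v => dotv v (y a - y b))}.
    exact/continuous_subspaceT/continuous_dotv.
  have /connected_intervalP := connected_continuous_connected cD cf.
  move=> /(_ (dotv v (y a - y b)) (dotv x (y a - y b)) (imageP _ Dv) (imageP _ Dx) 0).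
  rewrite !dotvBr => /(_ _)[|u Du]; first by apply/andP; split; lra.
  have us : uniq s by rewrite (perm_uniq sE) enum_uniq.
  have ab : a != b by rewrite nth_uniq //; apply/eqP; lia.
  rewrite dotvBr => /eqP; rewrite subr_eq0 => /eqP e1.
  have cu := DW _ Du.
  have [h|h|h] := ltngtP a b; last by rewrite (val_inj h) eqxx in ab.
  - by apply: cu; exists (a, b) => //; rewrite /orthv /= dotvBr e1 subrr.
  - by apply: cu; exists (b, a) => //; rewrite /orthv /= dotvBr e1 subrr.
apply: (@connected_component_max _ _ ((fun t => x + t *: (v - x)) @` `[0 : R, 1]%classic)).
- by exists 0; rewrite /= ?in_itv /= ?lexx ?ler01 // scale0r addr0.
- move=> _ [t /= + <-]; rewrite in_itv /= => /andP[t0 t1].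
  apply: (weyl_chambers_realizes sE).
  have -> : x + t *: (v - x) = (1 - t) *: x + t *: v.
    by rewrite scalerBr scalerBl scale1r addrA addrAC.
  have [t1'|t1'] := ltP t 1; first by apply: realizes_lin => //; lra.
  have -> : t = 1 by apply/eqP; rewrite eq_le t1 t1'.
  by rewrite subrr scale0r add0r scale1r.
- apply: connected_continuous_connected; first exact: segment_connected.
  exact/continuous_subspaceT/continuous_ray.
- by exists 1; rewrite /= ?in_itv /= ?lexx ?ler01 // scale1r addrC subrK.
Qed.

(** If v lies in the closed cone, v + t x realizes s for every positive t. *)
Lemma closure_chamber x s : realizes y x s ->
  closure [set v | realizes y v s] = weak_cone y s.
Proof.
move=> xs; apply/seteqP; split=> v.
  move=> cv; apply/(sortedP x0) => i si; rewrite -subr_ge0 -dotvBr.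
  set a := _ - _; pose H := (fun u => dotv u a) @^-1` [set r : R | 0 <= r].
  have cH : closed H.
    by apply: preimage_closed => [u _|]; [exact: continuous_dotv|exact: closed_ge].
  suff : H v by [].
  rewrite (closure_id H).1 //; apply: closureS cv => u us; rewrite /H /= dotvBr subr_ge0.
  by apply: ltW; apply: (sortedP x0 us).
move=> Cv B nB.
have /(_ B) := @continuous_ray v x 0; rewrite /= scale0r addr0 => /(_ nB).
move=> /nbhs_ballP[e /= e0 he]; exists (v + (e / 2) *: x); split.
  apply/(sortedP x0) => i si; rewrite !dotvDl !dotvZl.
  have := sortedP x0 xs i si; have := sortedP x0 Cv i si; nra.
apply: he; rewrite /ball /= sub0r normrN gtr0_norm; lra.
Qed.

Lemma weyl_tessellationE : weyl_tessellation y =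
  [set` [seq weak_cone y s | s <- permutations E & `[<realizable y (fun=> True) s>]]].
Proof.
apply/seteqP; split=> C.
  move=> [x cx <-]; have [s sE xs] := realizes_sort cx.
  rewrite (connected_component_chamber sE xs) (closure_chamber xs) /=.
  by apply: map_f; rewrite mem_filter mem_permutations sE andbT; apply/asboolP; exists x.
move=> /mapP[s]; rewrite mem_filter mem_permutations => /andP[/asboolP[x _ xs] sE] ->.
exists x; first exact: weyl_chambers_realizes xs.
by rewrite (connected_component_chamber sE xs) (closure_chamber xs).
Qed.

(** If the closed cones agree, the sum of the two witnesses realizes both orders. *)
Lemma weak_cone_inj s s' v v' : perm_eq s E -> perm_eq s' E ->
  realizes y v s -> realizes y v' s' -> weak_cone y s = weak_cone y s' -> s = s'.
Proof.
have realizes_sum t u w : realizes y u t -> weak_cone y t w -> realizes y (u + w) t.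
  move=> /(sortedP x0) ut /(sortedP x0) wt; apply/(sortedP x0) => i si.
  by rewrite !dotvDl; have := ut i si; have := wt i si; lra.
have sub t u : realizes y u t -> weak_cone y t u.
  by apply: sub_sorted => a b /ltW.
move=> sE s'E vs v's' ss'.
apply: (@irr_sorted_eq _ (fun a b => dotv (v + v') (y b) < dotv (v + v') (y a))).
- exact: gt_dotv_trans.
- by move=> a; apply: ltxx.
- by apply: realizes_sum => //; rewrite ss'; apply: sub.
- by rewrite addrC; apply: realizes_sum => //; rewrite -ss'; apply: sub.
- by move=> a; rewrite (perm_mem sE) (perm_mem s'E).
Qed.

End Tessellation.

(** * Expectation *)

Section Expectation.
Context {R : realType} (disp : measure_display) (T : measurableType disp).
Variable P : probability T R.
Local Open Scope ereal_scope.
Import HBNNSimple.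

(** The integral of a nonnegative function is a supremum over the simple functions
below it, whence monotonicity without measurability. *)
Lemma ge0_integral_mono (f g : T -> \bar R) : (forall w, 0 <= f w) ->
  (forall w, f w <= g w) -> \int[P]_w f w <= \int[P]_w g w.
Proof.
move=> f0 fg; have g0 w : 0 <= g w := le_trans (f0 w) (fg w).
rewrite !ge0_integralTE //; apply: ereal_sup_le => _ [h hf <-].
by exists h => // w; apply: le_trans (hf w) (fg w).
Qed.

(** A function that is almost everywhere constant need not be measurable.  Simple
functions below f are at most c almost everywhere, and f is at least c times the
indicator of the complement of a measurable null set. *)
Lemma expectation_ae_cst (f : T -> R) (c : R) : (forall w, 0 <= f w)%R ->
  (0 <= c)%R -> {ae P, forall w, f w = c} -> 'E_P[f] = c%:E.
Proof.
move=> f0 c0 [N [mN PN fN]]; rewrite unlock.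
have fc w : ~ N w -> f w = c by move=> nN; apply: contrapT => fw; exact/nN/fN.
have intc : \int[P]_w (cst c%:E w) = c%:E.
  by rewrite integral_cst // [X in _ * X]probability_setT mule1.
apply/eqP; rewrite eq_le; apply/andP; split.
  have f0' w : 0 <= (f w)%:E by rewrite lee_fin.
  rewrite (@ge0_integralTE _ _ _ P (fun w => (f w)%:E) f0').
  apply: ge_ereal_sup => _ [h hf <-]; rewrite -intc.
  have -> : sintegral P h = \int[P]_w (h w)%:E.
    by rewrite integral_nnsfun //= patch_setT.
  apply: ae_ge0_le_integral => //.
  - by move=> w _; rewrite lee_fin.
  - exact/measurable_EFinP.
  - exists N; split=> // w /= /not_implyP[_ hw]; apply: contrapT => /fc fw.
    by apply: hw; rewrite -fw; exact: hf.
have m1 : measurable_fun [set: T] (fun w => (c * \1_(~` N) w)%:E).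
  apply/measurable_EFinP; apply: measurable_funM => //.
  by apply: measurable_indic; exact: measurableC.
rewrite -intc (@ge0_ae_eq_integral _ _ _ _ _ _ (fun w => (c * \1_(~` N) w)%:E)) //.
- apply: ge0_integral_mono => w; first by rewrite lee_fin mulr_ge0.
  rewrite lee_fin indicE; case: (boolP (w \in ~` N)) => [|_].
    by rewrite inE => /fc ->; rewrite mulr1.
  by rewrite mulr0.
- by move=> w _; rewrite lee_fin mulr_ge0.
exists N; split=> // w /= h; apply: contrapT => Nw; apply: h => _.
by rewrite indicE mem_set // mulr1.
Qed.

End Expectation.

Section Average.
Context {R : realType} {d n : nat} (x0 : 'I_n) (y : 'I_n -> 'rV[R]_d).
Hypothesis gy : type_A_general_position y.
Local Notation E := (enum 'I_n).

Let orders := [seq s <- permutations E | `[<realizable y (fun=> True) s>]].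

Let uniq_cones : uniq [seq weak_cone y s | s <- orders].
Proof.
rewrite map_inj_in_uniq ?filter_uniq ?permutations_uniq // => s s'.
rewrite !mem_filter !mem_permutations => /andP[/asboolP[v _ vs] sE].
move=> /andP[/asboolP[v' _ v's'] s'E]; exact: (weak_cone_inj x0 sE s'E vs v's').
Qed.

Lemma card_weyl_tessellation : (1 <= d)%N ->
  #|` fset_set (weyl_tessellation y)|%fset = DA n d.
Proof.
move=> d1; have [dn _] := gy; rewrite (@card_fset_set_seq _ _ _ uniq_cones); last first.
  by move=> C; rewrite (weyl_tessellationE x0).
rewrite size_map size_filter -sum1_count big_mkcond.
have <- : nrealizable y (fun=> True) E = DA n d.
  rewrite (nrealizable_eq_DA (enum_uniq _) _ (generic_type_A gy)) size_enum_ord //; lia.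
by apply: eq_bigr => s _; case: asboolP.
Qed.

Lemma weyl_average_num_faces k : (1 <= k <= d)%N ->
  weyl_average y (fun C => (num_faces k C)%:R) =
  ('C(n.-1, d - k) * DA (n - d + k) k)%N%:R / (DA n d)%:R
   * ((n`!)%:R / ((n - d + k)`!)%:R) :> R.
Proof.
move=> kd; rewrite /weyl_average card_weyl_tessellation; last by lia.
rewrite (weyl_tessellationE x0) -fsbig_seq // big_map big_filter -natr_sum.
have m0 : ((n - d + k)`!%:R : R) != 0 by rewrite pnatr_eq0 -lt0n fact_gt0.
have := congr1 (fun m => m%:R : R) (sum_num_faces x0 gy kd).
rewrite !natrM => h; rewrite -[X in _ * X](mulKf m0) h.
by ring.
Qed.

End Average.

Unset Implicit Arguments.
Set Strict Implicit.
Set Printing Implicit Defensive.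

Theorem theorem1p5 (R : realType) (disp : measure_display)
    (T : measurableType disp) (P : probability T R) (d n k : nat)
    (Y : 'I_n -> T -> 'rV[R]_d) :
  (2 <= d)%N ->
  (forall i j, measurable_fun [set: T] (fun w => Y i w ord0 j)) ->
  {ae P, forall w, type_A_general_position (fun i => Y i w)} ->
  (1 <= k <= d)%N ->
  weyl_cone_expectation P Y (fun C => (num_faces k C)%:R) =
  (('C(n.-1, d - k) * DA (n - d + k) k)%N%:R / (DA n d)%:R
   * ((n`!)%:R / ((n - d + k)`!)%:R))%:E.
Proof.
move=> d2 _ gY kd; rewrite /weyl_cone_expectation; apply: expectation_ae_cst.
- move=> w; rewrite /weyl_average mulr_ge0 ?invr_ge0 ?ler0n //.
  by rewrite fsumr_ge0.
- by rewrite !mulr_ge0 ?invr_ge0 ?ler0n.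
apply: filterS gY => w gw; have [dn _] := gw.
have n0 : (0 < n)%N by lia.
exact: (weyl_average_num_faces (Ordinal n0) gw kd).
Qed.
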